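(* With the zeros $z_{j,n}$ of the Geometric polynomials $P_n$ numbered as in the context, we have \[ z_{j,2n}=-\frac12+\frac{\pi^2}{4}\,\frac{j}{n+1}+o\!\left(\frac1n\right)\quad\text{as } n\to\infty, \] for each $j=0,1,\ldots$, while \[ z_{j,2n+1}=-\frac12+\frac{\pi^2}{8}\,\frac{2j-1}{n+1}+o\!\left(\frac1n\right)\quad\text{as } n\to\infty, \] for each $j=1,2,\ldots$. For negative index the corresponding zeros are defined by the symmetric relation $z_{-j,n}+z_{j,n}=-1$. The distance of consecutive zeros of $P_n$ in the bulk of $(-1,0)$ is of order $\frac{\pi^2}{4n}+o\!\left(\frac1n\right)$ as $n\to\infty$.
   Context: The Geometric polynomials $(P_n(z))_{n\ge0}$ are defined by the exponential generating function \[ \frac{1}{1-z(e^t-1)}=\sum_{n=0}^\infty P_n(z)\frac{t^n}{n!}. \] For $n\ge1$, $P_n$ has degree $n$, its zeros are simple and lie in $(-1,0]$, and the zeros different from $0$ are symmetric with respect to $-1/2$; moreover $P_{2k}(-1/2)=0$ for $k\ge1$ and $P_{2k+1}(-1/2)\neq0$, so even and odd indices are distinguished. The zeros of $P_n$ are numbered with respect to $-1/2$: they are denoted by $z_{j,n}$, with $j$ positive or negative depending on whether they lie to the right or to the left of $-1/2$, starting from the zero nearest to $-1/2$ and taking into account that $z_{-j,n}+z_{j,n}=-1$; for even degree the index $j=0$ corresponds to the zero $z_{0,2n}=-1/2$. The bulk of the interval $(-1,0)$ is understood as any interval $(-1-a,a)$ with $a\in(-1/2,0)$ fixed.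
   Formalization: In the formulas for z_{j,2n} and z_{j,2n+1}, n+1 is corrected to 2n+1 and 2n+2 (degree plus one). ''Of order π²/(4n)+o(1/n)'' in the bulk becomes: at most that, at least cπ²/(4n) with c>0 depending on a, and equal up to ε/n near -1/2. *)

(* Defs.v *)
From mathcomp Require Import all_boot all_order all_algebra.
From mathcomp Require Import all_classical all_reals all_analysis.
From mathcomp.real_closed Require Import polyrcf.
Import Order.TTheory GRing.Theory Num.Theory.
Import numFieldNormedType.Exports.

Set Implicit Arguments.
Unset Strict Implicit.
Unset Printing Implicit Defensive.

Local Open Scope classical_set_scope.
Local Open Scope ring_scope.

(* The radius of convergence in t depends on z, hence the order of the
   quantifiers.  Since R is infinite and power series expansions are unique,
   at most one family of polynomials P satisfies this. *)
Definition geometric_polys (R : realType) (P : nat -> {poly R}) : Prop :=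
  forall z : R, \forall t \near (0 : R),
    series (fun n => (P n).[z] * (t ^+ n / n`!%:R)) @ \oo
      --> (1 - z * (expR t - 1))^-1.

(* rootsR lists the distinct real roots in increasing order.  The root 0 is
   not numbered, as its mirror image -1 is not a root. *)
Definition right_zeros (R : realType) (p : {poly R}) : seq R :=
  [seq x <- rootsR p | (x != 0) && (- 2^-1 < x)].

Definition left_zeros (R : realType) (p : {poly R}) : seq R :=
  [seq x <- rootsR p | (x != 0) && (x < - 2^-1)].

(* The zero z_j of p, counted from -1/2: for j > 0 the j-th nearest one on the
   right, for j < 0 the |j|-th nearest one on the left, and -1/2 for j = 0.
   An index j exceeding the number of zeros on its side yields the junk
   value -1/2. *)
Definition zero_idx (R : realType) (p : {poly R}) (j : int) : R :=
  match j with
  | Posz 0 => - 2^-1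
  | Posz k.+1 => nth (- 2^-1) (right_zeros p) k
  | Negz k => nth (- 2^-1) (rev (left_zeros p)) k
  end.

Definition consecutive_zeros (R : realType) (p : {poly R}) (x y : R) : Prop :=
  [/\ x < y, root p x, root p y & forall u, x < u < y -> ~~ root p u].

(* Main.v *)
(* For -1 < z < 0 write z = -1 / (1 + e^q).  As a function of t, the function
   (1 + z) / (1 - z (e^t - 1)) has its poles at q + i pi (2 k + 1), k in Z, and
   expanding it into partial fractions gives
     (1 + z) P_n(z) / n! = sum_k (q + i pi (2 k + 1))^(-n-1).
   The poles q + i pi and q - i pi dominate, locally uniformly in q, so that up to
   a positive factor P_n(z) is cos ((n + 1) (pi / 2 - phi)) + o(1), where
   phi = atan (q / pi).  To avoid complex analysis, e^t is first replaced by
   (1 + t / N)^N, for which the partial fraction expansion is a finite identity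
   on the N-th roots of -e^q, and N tends to infinity for fixed n.
   Hence consecutive zeros in the bulk have phi-distance pi / (n + 1) + o(1 / n):
   the intermediate value theorem gives enough zeros, and Rolle's theorem
   together with P_(n+1) = X ((1 + X) P_n)' excludes additional ones. *)

Require Import Defs.
From mathcomp Require Import all_boot all_order all_algebra.
From mathcomp Require Import all_classical all_reals all_analysis.
From mathcomp.real_closed Require Import polyrcf complex.
From mathcomp Require Import ring lra zify.
Import Order.TTheory GRing.Theory Num.Theory.
Import numFieldNormedType.Exports.
Set Implicit Arguments.
Unset Strict Implicit.
Unset Printing Implicit Defensive.
Local Open Scope classical_set_scope.
Local Open Scope ring_scope.

(** * Recurrences for the geometric polynomials *)

(** The generating function is known only for t in a neighbourhood of 0 that depends on z. It is
    used once, to extract the recurrence [gcoef_rec]; positivity, symmetry, the derivative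
    recurrence and the link with the partial fractions all follow from it. The obstacle in the limit
    N -> oo is an error bound, uniform in N, for the N - 2 poles that do not dominate. It rests on
    the sum of 1 / |pole|^2 at q = 0, which is exactly 1/4 for every N > 1, and on a comparison of
    |pole|^2 at q with its value at 0. The constants of the theorem come from d phi / dz, whose
    least value 4 / pi is taken at z = -1/2: there the phi-distance pi / (n + 1) becomes the
    distance pi^2 / (4 (n + 1)). Away from -1/2 the zeros lie closer together. Hence the spacing
    statement has a sharp upper bound on the whole bulk, a lower bound whose constant depends on a,
    and an asymptotic equality only near -1/2. *)

Lemma power_series_terms_bounded (R : realType) (c : nat -> R) (r : R) :
  cvgn (series (fun n => c n * r ^+ n)) ->
  exists2 M, 0 < M & forall n, `|c n * r ^+ n| <= M.
Proof.
move=> /cvg_series_bounded/pinfty_ex_gt0[M M0 HM].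
by exists M => // n; exact: HM.
Qed.

(** The terms are dominated by a geometric series of ratio t / r <= 1/2, whose tails are at most
    twice their first term; hence the factor 2. *)
Lemma power_series_remainder (R : realType) (c : nat -> R) (r M t l : R) (m : nat) :
  0 < r -> (forall n, `|c n * r ^+ n| <= M) -> 0 <= t -> t <= r / 2 ->
  series (fun n => c n * t ^+ n) @ \oo --> l ->
  `|l - \sum_(i < m) c i * t ^+ i| <= 2 * M / r ^+ m * t ^+ m.
Proof.
move=> r0 cM t0 tr cl.
have M0 : 0 <= M by apply: le_trans (cM 0%N).
set x := t / r.
have x0 : 0 <= x by rewrite divr_ge0 // ltW.
have x2 : x <= 2^-1 by rewrite ler_pdivrMr // mulrC.
have term n : `|c n * t ^+ n| <= M * x ^+ n.
  have -> : c n * t ^+ n = c n * r ^+ n * x ^+ n.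
    by rewrite /x -mulrA -exprMn mulrCA divff ?mulr1 ?gt_eqF.
  by rewrite normrM [`|x ^+ n|]ger0_norm ?exprn_ge0 // ler_wpM2r ?exprn_ge0.
have geo k n : \sum_(k <= i < k + n) x ^+ i <= 2 * x ^+ k.
  elim: n k => [|n IH] k; first by rewrite addn0 big_geq // mulr_ge0 // exprn_ge0.
  rewrite big_ltn ?addnS ?ltnS ?leq_addr // -addSn.
  apply: le_trans (lerD (lexx _) (IH k.+1)) _.
  by rewrite exprS; have := exprn_ge0 k x0; nra.
have -> : 2 * M / r ^+ m * t ^+ m = M * (2 * x ^+ m).
  by rewrite /x expr_div_n; ring.
have cl' : (fun n => `|series (fun n => c n * t ^+ n) n - \sum_(i < m) c i * t ^+ i|)
    @ \oo --> `|l - \sum_(i < m) c i * t ^+ i|.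
  by apply: cvg_norm; apply: cvgB => //; exact: cvg_cst.
apply: (cvgr_to_le cl'); exists m => // n /= mn.
rewrite /series /= -(big_mkord xpredT (fun i => c i * t ^+ i)).
rewrite (big_cat_nat (leq0n m) mn) /= addrAC subrr add0r.
apply: le_trans (ler_norm_sum _ _ _) _.
apply: le_trans (ler_sum _ (fun i _ => term i)) _.
by rewrite -mulr_sumr ler_wpM2l // -(subnKC mn) geo.
Qed.

(** The bound at t -> 0+ kills the constant coefficient; dividing by X lowers m by one. This serves
    as the uniqueness of Taylor coefficients. *)
Lemma poly_coef0_of_bound (R : realType) (p : {poly R}) (C r : R) (m : nat) :
  0 < r -> (forall t, 0 < t -> t < r -> `|p.[t]| <= C * t ^+ m) ->
  forall i, (i < m)%N -> p`_i = 0.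
Proof.
move=> r0; elim: m p C => // m IH p C pC.
have p0 : p.[0] = 0.
  apply/eqP; rewrite -normr_le0.
  have h1 : (fun t => `|p.[t]|) @ 0^'+ --> `|p.[0]|.
    apply: cvg_norm; apply: cvg_at_right_filter.
    exact: continuous_horner.
  have h2 : (fun t => C * t ^+ m.+1) @ 0^'+ --> C * 0 ^+ m.+1.
    apply: cvg_at_right_filter; apply: cvgMr.
    exact: exprn_continuous.
  have := ler_cvg_to h1 h2; rewrite expr0n mulr0; apply.
  near=> t; apply: pC; near: t; first exact: nbhs_right_gt.
  exact: nbhs_right_lt.
have /factor_theorem[q qE] : root p 0 by apply/rootP.
rewrite subr0 in qE; rewrite qE.
have qC t : 0 < t -> t < r -> `|q.[t]| <= C * t ^+ m.
  move=> t0 tr; have := pC t t0 tr.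
  rewrite qE hornerMX normrM (gtr0_norm t0) exprSr mulrA ler_pM2r //.
move=> [|i] im; rewrite coefMX //=.
exact: IH qC _ im.
Unshelve. all: by end_near. Qed.

Definition gcoef (R : realType) (P : nat -> {poly R}) (z : R) (n : nat) : R :=
  (P n).[z] / n`!%:R.

(** This compares the coefficients of t^n in F(t) (1 + z - z e^t) = 1. Both series are cut to
    polynomials of degree at most n, so that no product of infinite series is formed: the defect [D]
    is O(t^(n+1)), and its coefficients up to n vanish. *)
Lemma gcoef_rec (R : realType) (P : nat -> {poly R}) (z : R) (n : nat) :
  geometric_polys P ->
  (1 + z) * gcoef P z n - z * \sum_(j < n.+1) gcoef P z j / (n - j)`!%:R
  = (n == 0%N)%:R.
Proof.
move=> /(_ z) Pz; set c := gcoef P z.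
(* On this neighbourhood the denominator 1 - z (e^t - 1) is nonzero and at most 2 in absolute
   value. *)
have Ez : \forall t \near (0 : R), `|z * (expR t - 1)| < 1.
  have : (fun t => z * (expR t - 1)) @ (0 : R) --> z * (expR 0 - 1).
    by apply: cvgMr; apply: cvgB; [exact: continuous_expR|exact: cvg_cst].
  rewrite expR0 subrr mulr0 => /cvgr0Pnorm_lt; exact.
have [r0 /= r00 Hr0] := (nbhs_ballP _ _).1 (filterI Pz Ez).
pose r := r0 / 2.
have rp : 0 < r by rewrite divr_gt0.
have inb t : 0 <= t -> t <= r -> ball (0 : R) r0 t.
  move=> t0 tr; rewrite /ball /= sub0r normrN ger0_norm //.
  by apply: le_lt_trans tr _; rewrite /r; lra.
have cs t : 0 <= t -> t <= r ->
    series (fun n => c n * t ^+ n) @ \oo --> (1 - z * (expR t - 1))^-1 /\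
    `|z * (expR t - 1)| < 1.
  move=> t0 tr; have [/= h1 h2] := Hr0 _ (inb t t0 tr); split => //.
  rewrite (_ : (fun n => _) = (fun n => (P n).[z] * (t ^+ n / n`!%:R))) //.
  by apply/funext => i; rewrite /c /gcoef mulrAC mulrA.
have [M M0 cM] : exists2 M, 0 < M & forall n, `|c n * r ^+ n| <= M.
  apply: power_series_terms_bounded.
  by have [h _] := cs r (ltW rp) (lexx _); apply/cvg_ex; eexists; exact: h.
pose e (n : nat) : R := n`!%:R^-1.
have es t : series (fun n => e n * t ^+ n) @ \oo --> expR t.
  rewrite (_ : (fun n => _) = exp_coeff t); last first.
    by apply/funext => i; rewrite /e exp_coeffE /=.
  exact: is_cvg_series_exp_coeff.
have [M' M'0 eM] : exists2 M, 0 < M & forall n, `|e n * r ^+ n| <= M.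
  apply: power_series_terms_bounded.
  by apply/cvg_ex; eexists; exact: es.
set m := n.+1.
pose A := \poly_(i < m) c i; pose E := \poly_(i < m) e i.
have AE t : A.[t] = \sum_(i < m) c i * t ^+ i by rewrite horner_poly.
have EE t : E.[t] = \sum_(i < m) e i * t ^+ i by rewrite horner_poly.
pose D := A * ((1 + z)%:P - z *: E) - 1.
have DE t : D.[t] = A.[t] * (1 + z - z * E.[t]) - 1 by rewrite !hornerE.
pose K1 := 2 * M / r ^+ m; pose K2 := 2 * M' / r ^+ m.
have K10 : 0 <= K1 by rewrite !mulr_ge0 ?invr_ge0 ?exprn_ge0 // ltW.
have K20 : 0 <= K2 by rewrite !mulr_ge0 ?invr_ge0 ?exprn_ge0 // ltW.
pose B := 2 * M; pose B' := B *+ 2.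
have Dbound t : 0 < t -> t < r / 2 ->
    `|D.[t]| <= (K1 * 2 + B' * (`|z| * K2)) * t ^+ m.
  move=> t0 tr.
  have tr' : t <= r by apply: le_trans (ltW tr) _; lra.
  have [Fs Fz] := cs t (ltW t0) tr'.
  set F := (1 - z * (expR t - 1))^-1 in Fs.
  have hA : `|F - A.[t]| <= K1 * t ^+ m.
    rewrite AE; apply: power_series_remainder => //; exact: ltW.
  have hE : `|expR t - E.[t]| <= K2 * t ^+ m.
    rewrite EE; apply: power_series_remainder => //; exact: ltW.
  have FF : F * (1 - z * (expR t - 1)) = 1.
    by rewrite mulVf // subr_eq0; apply/eqP => h; move: Fz; rewrite -h normr1 ltxx.
  have hF : `|F| <= B.
    have := @power_series_remainder R c r M t F 0%N rp cM (ltW t0) (ltW tr) Fs.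
    by rewrite big_ord0 subr0 !expr0 divr1 mulr1.
  have hG : `|1 - z * (expR t - 1)| <= 2.
    apply: le_trans (ler_normB _ _) _; rewrite normr1.
    by move: Fz; lra.
  (* The constant 1 in [D] is replaced by F (1 - z (e^t - 1)), which leaves only the two truncation
     errors. *)
  have -> : D.[t] = - ((F - A.[t]) * (1 - z * (expR t - 1))) +
     (A.[t]) * (z * (expR t - E.[t])).
    by rewrite DE -[X in _ - X = _]FF; ring.
  have hA' : `|A.[t]| <= B'.
    have -> : A.[t] = F - (F - A.[t]) by rewrite opprB addrC subrK.
    apply: le_trans (ler_normB _ _) _; rewrite /B' mulr2n; apply: lerD => //.
    apply: le_trans hA _; rewrite /K1 mulrAC ler_pdivrMr ?exprn_gt0 //.
    rewrite ler_wpM2l ?mulr_ge0 ?(ltW M0) //.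
    by rewrite lerXn2r ?nnegrE ?ltW // (lt_le_trans tr) //; lra.
  apply: le_trans (ler_normD _ _) _.
  rewrite normrN !normrM mulrDl; apply: lerD.
    rewrite mulrAC; apply: ler_pM => //.
  rewrite -(mulrA B') -(mulrA `|z| K2); apply: ler_pM; rewrite ?mulr_ge0 //.
  by rewrite ler_wpM2l.
have r20 : 0 < r / 2 by rewrite divr_gt0.
have := poly_coef0_of_bound r20 Dbound (ltnSn n).
rewrite /D coefB coef1 mulrBr coefB coefMC -scalerAr coefZ coef_poly /m ltnSn.
rewrite coefM => /eqP; rewrite subr_eq0 => /eqP <-.
rewrite mulrC; congr (_ - _ * _); apply: eq_bigr => i _.
by rewrite !coef_poly ltn_ord ltnS leq_subr.
Qed.

Lemma poly_eq0_horner (R : realDomainType) (p : {poly R}) :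
  (forall x, p.[x] = 0) -> p = 0.
Proof.
move=> p0; apply/eqP/negPn/negP => pn0.
have := max_poly_roots pn0 _ _ (rs := [seq i%:R | i <- iota 0 (size p)]).
rewrite size_map size_iota ltnn => h; apply/negP: isT; rewrite negbT // h //.
  by apply/allP => x _; apply/rootP.
by rewrite map_inj_uniq ?iota_uniq //; apply: mulrIn; rewrite oner_eq0.
Qed.

Section Recurrence.
Variables (R : realType) (P : nat -> {poly R}).
Hypothesis P_geom : geometric_polys P.

Lemma gcoef_lin (z : R) (n : nat) :
  gcoef P z n = (n == 0%N)%:R + z * \sum_(j < n) gcoef P z j / (n - j)`!%:R.
Proof.
have := gcoef_rec z n P_geom; rewrite big_ord_recr /= subnn fact0 divr1 => <-.
by ring.
Qed.

(** [e] and [p] are the coefficients in t of e^t and of the generating function, and [S f] those of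
    the product of e^t with the series of [f]. With z replaced by X the recurrence becomes a
    polynomial identity and can be differentiated in z. *)
Let e k : {poly R} := (k`!%:R^-1)%:P.
Let p n := (n`!%:R^-1) *: P n.
Let S (f : nat -> {poly R}) n := \sum_(j < n.+1) e (n - j) * f j.

Let prec n : (1 + 'X) * p n - 'X * S p n = (n == 0%N)%:R.
Proof.
apply/eqP; rewrite -subr_eq0; apply/eqP/poly_eq0_horner => z.
rewrite /S !hornerE /= horner_sum.
have -> : ((n == 0%N)%:R : {poly R}).[z] = (n == 0%N)%:R by rewrite -polyC_natr hornerC.
rewrite -(gcoef_rec z n P_geom) /gcoef; apply/eqP; rewrite subr_eq0; apply/eqP.
congr (_ - _ * _); first by rewrite mulrAC mulrA.
by apply: eq_bigr => i _; rewrite /e /p hornerCM hornerZ mulrC (mulrC _ (P i).[z]).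
Qed.

(** F = 1 / (1 + z - z e^t) satisfies dF/dt = z F + z (1 + z) dF/dz, and [a n] is the coefficient of
    t^n in the difference of the two sides. *)
Lemma geometric_poly_deriv_rec n : P n.+1 = 'X * ((1 + 'X) * P n)^`().
Proof.
pose a n := n.+1%:R * p n.+1 - 'X * p n - 'X * (1 + 'X) * (p n)^`().
have fn0 k : k`!%:R != 0 :> R by rewrite pnatr_eq0 -lt0n fact_gt0.
have Pp k : P k = k`!%:R%:P * p k.
  by rewrite /p -mul_polyC mulrA -polyCM mulfV // mul1r.
have e0 : e 0 = 1 by rewrite /e fact0 invr1.
have eS k : k.+1%:R * e k.+1 = e k.
  rewrite /e -polyC_natr -polyCM.
  by rewrite factS natrM invfM mulVKf // pnatr_eq0.
have SS k : k.+1%:R * S p k.+1 = S (fun j => j.+1%:R * p j.+1) k + S p k.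
  rewrite /S mulr_sumr.
  have E1 : \sum_(i < k.+1) e (k - i) * (i.+1%:R * p i.+1) =
      \sum_(i < k.+2) e (k.+1 - i) * (i%:R * p i).
    rewrite [RHS]big_ord_recl /= mul0r mulr0 add0r.
    by apply: eq_bigr => i _; rewrite subSS.
  rewrite E1 big_ord_recr [X in _ = X + _]big_ord_recr /= subnn e0 addrAC.
  rewrite -big_split /=; congr (_ + _); last by ring.
  apply: eq_bigr => i _.
  have ik : (i <= k)%N by rewrite -ltnS.
  rewrite subSn // -[X in _ = _ + X * _]eS.
  have -> : k.+1%:R = i%:R + (k - i).+1%:R :> {poly R}.
    by rewrite -natrD addnS subnKC.
  by ring.
(* The difference times the denominator of F vanishes: this combines the derivative of the
   recurrence in t, which is [SS], with its derivative in z, which is [dp]. *)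
have ha k : (1 + 'X) * a k - 'X * S a k = 0.
  have Sa : S a k = S (fun j => j.+1%:R * p j.+1) k - 'X * S p k
     - 'X * (1 + 'X) * S (fun j => (p j)^`()) k.
    rewrite /S !mulr_sumr -!sumrB; apply: eq_bigr => i _.
    by rewrite /a; ring.
  have dp : p k + (1 + 'X) * (p k)^`() - S p k - 'X * S (fun j => (p j)^`()) k = 0.
    have : ((1 + 'X) * p k - 'X * S p k)^`() = 0.
      by rewrite prec -polyC_natr derivC.
    rewrite derivB !derivM derivD derivX -(polyC1) derivC add0r !mul1r => <-.
    rewrite -[(S p k)^`()](_ : S (fun j => (p j)^`()) k = _) ?polyC1; last first.
      rewrite /S raddf_sum; apply: eq_bigr => i _.
      by rewrite /= derivM derivC mul0r add0r.
    by ring.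
  have r1 := prec k.+1; rewrite /= in r1.
  have S1 : S (fun j => j.+1%:R * p j.+1) k = k.+1%:R * S p k.+1 - S p k.
    by rewrite SS addrK.
  rewrite Sa S1 /a.
  transitivity (k.+1%:R * ((1 + 'X) * p k.+1 - 'X * S p k.+1) - 'X * (1 + 'X) *
      (p k + (1 + 'X) * (p k)^`() - S p k - 'X * S (fun j => (p j)^`()) k)).
    by ring.
  by rewrite r1 dp; ring.
(* The denominator has constant term (1 + X) - X = 1 in t, so the convolution with it is
   injective. *)
have a0 k : a k = 0.
  elim/ltn_ind: k => k IH; have := ha k.
  rewrite /S big_ord_recr /= big1 ?add0r => [|i _]; last first.
    by rewrite IH ?mulr0.
  by rewrite subnn e0 mul1r => <-; ring.
have h : n.+1%:R * p n.+1 = 'X * p n + 'X * (1 + 'X) * (p n)^`().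
  by apply/eqP; rewrite -subr_eq0 opprD addrA -(a0 n).
rewrite (Pp n.+1) (Pp n) factS natrM polyCM polyC_natr.
rewrite mulrAC h.
rewrite derivM derivD derivX -polyC1 derivC add0r mul1r derivM derivC mul0r add0r polyC1.
by ring.
Qed.
Lemma geometric_poly0 : P 0 = 1.
Proof.
apply/eqP; rewrite -subr_eq0; apply/eqP/poly_eq0_horner => z.
have := gcoef_lin z 0; rewrite big_ord0 mulr0 addr0 /gcoef fact0 divr1 => h.
by rewrite hornerD h hornerN hornerC subrr.
Qed.

(** The recurrence has only positive coefficients when z > 0. Together with the symmetry this
    confines the zeros to (-1, 0]. *)
Lemma geometric_poly_gt0 n z : 0 < z -> 0 < (P n).[z].
Proof.
move=> z0; suff : 0 < gcoef P z n.
  by rewrite /gcoef pmulr_lgt0 // invr_gt0 ltr0n fact_gt0.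
elim/ltn_ind: n => -[|n] IH; rewrite gcoef_lin.
  by rewrite big_ord0 mulr0 addr0.
have pos (j : 'I_n.+1) : 0 < gcoef P z j / (n.+1 - j)`!%:R.
  by rewrite divr_gt0 ?IH // ltr0n fact_gt0.
rewrite add0r mulr_gt0 // big_ord_recl ltr_pwDl ?pos //.
by apply: sumr_ge0 => i _; exact/ltW/pos.
Qed.

Lemma geometric_poly_neq0 n : P n != 0.
Proof.
apply/eqP => P0; have := geometric_poly_gt0 n ltr01.
by rewrite P0 horner0 ltxx.
Qed.

(** The symmetric object is Q with P_(n+1) = X Q. The factor X (1 + X) is invariant under z -> -1 -
    z, and each derivation contributes one sign. *)
Lemma geometric_poly_symm n z :
  z * (P n.+1).[-1 - z] = (-1) ^+ n.+1 * (1 + z) * (P n.+1).[z].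
Proof.
suff [Q -> Qs] : exists2 Q, P n.+1 = 'X * Q & Q \Po (-1 - 'X) = (-1) ^+ n *: Q.
  rewrite !hornerM !hornerX.
  have -> : Q.[-1 - z] = (-1) ^+ n * Q.[z].
    by rewrite -hornerZ -Qs horner_comp !hornerE.
  by rewrite exprS; ring.
elim: n => [|n [Q PQ Qs]].
  exists 1; first by rewrite geometric_poly_deriv_rec geometric_poly0 mulr1 derivD derivX -polyC1 derivC add0r.
  by rewrite expr0 scale1r -polyC1 comp_polyC.
exists ((1 + 'X) * P n.+1)^`(); first exact: geometric_poly_deriv_rec.
set T := (1 + 'X) * P n.+1.
have TS : T \Po (-1 - 'X) = (-1) ^+ n *: T.
  rewrite /T PQ !comp_polyM Qs comp_polyD -polyC1 comp_polyC comp_polyX polyC1.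
  by rewrite -!mul_polyC; ring.
have := congr1 (@deriv R) TS.
have -> : (T \Po (-1 - 'X))^`() = - (T^`() \Po (-1 - 'X)).
  by rewrite deriv_comp derivB derivX derivN -polyC1 derivC oppr0 sub0r mulrN1.
by rewrite derivZ exprS mulN1r scaleNr => <-; rewrite opprK.
Qed.

Lemma geometric_poly_rootN1 n : ~~ root (P n) (-1).
Proof.
suff -> : root (P n) (-1) = false by [].
rewrite rootE; elim: n => [|n IH]; first by rewrite geometric_poly0 hornerC oner_eq0.
rewrite geometric_poly_deriv_rec derivM derivD derivX -polyC1 derivC !hornerE /=.
by rewrite addrN mul0r addr0 mulN1r oppr_eq0.
Qed.

Lemma geometric_poly_root_symm n z : z != 0 -> z != -1 ->
  root (P n) (-1 - z) = root (P n) z.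
Proof.
move=> z0 z1; case: n => [|n]; first by rewrite geometric_poly0 !rootE !hornerE.
rewrite !rootE -(mulrI_eq0 (P n.+1).[-1 - z] (mulfI z0)) geometric_poly_symm.
rewrite mulf_eq0 mulf_eq0 signr_eq0 /= addrC addr_eq0 (negPf z1) //.
Qed.

Lemma geometric_poly_root_itv n z : root (P n) z -> z != 0 -> -1 < z < 0.
Proof.
move=> Pz z0; have z1 : z != -1.
  by apply: contraTneq Pz => ->; exact: geometric_poly_rootN1.
have neg x : root (P n) x -> x <= 0.
  rewrite leNgt => /rootP Px; apply/negP => /(geometric_poly_gt0 n).
  by rewrite Px ltxx.
have zl := neg z Pz.
have := neg (-1 - z); rewrite geometric_poly_root_symm // => /(_ Pz).
rewrite !lt_neqAle z0 zl eq_sym z1 /=; lra.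
Qed.

Lemma geometric_poly_root_half n : (0 < n)%N -> ~~ odd n -> root (P n) (- 2^-1).
Proof.
case: n => // n _; rewrite /= negbK => on.
have := geometric_poly_symm n (- 2^-1).
rewrite exprS -signr_odd on expr1 rootE.
rewrite (_ : -1 - - 2^-1 = - 2^-1); last by field.
by move=> h; apply/eqP; lra.
Qed.

End Recurrence.

(** * Partial fractions over roots of unity *)

Section PartialFractions.
Variables (F : fieldType) (N : nat) (y : 'I_N -> F) (Y : F).
Hypothesis N_neq0 : N%:R != 0 :> F.
Hypothesis yN : forall k, y k ^+ N = Y.
Hypothesis Y_neq1 : Y != 1.
Hypothesis sum_y : forall l, (0 < l < N)%N -> \sum_k y k ^+ l = 0.

(** The function Y / (Y - (1 + t / N)^N) has the simple poles N (y k - 1) with residues - y k;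
    expanding each fraction as a geometric series in t gives this coefficient of t^n. *)
Definition pole_sum n : F := \sum_k y k / (N%:R * (y k - 1)) ^+ n.+1.

Let y_neq1 k : y k - 1 != 0.
Proof.
rewrite subr_eq0; apply: contraNneq Y_neq1 => yk.
by rewrite -(yN k) yk expr1n.
Qed.

(** After the binomial expansion the factor y k excludes the exponent 0, and among the exponents 1,
    ..., m + 1 <= N only N has a nonzero power sum. *)
Let sum_y_subX m : (m < N)%N ->
  \sum_k y k * (y k - 1) ^+ m = (m.+1 == N)%:R * (N%:R * Y).
Proof.
move=> mN.
transitivity (\sum_(i < m.+1) ((-1) ^+ (m - i) *+ 'C(m, i)) * \sum_k y k ^+ i.+1).
  under eq_bigr => k _.
    rewrite [y k - 1]addrC exprDn mulr_sumr.
    under eq_bigr => i _ do rewrite mulrnAr mulrCA -exprS -mulrnAl.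
    over.
  by rewrite exchange_big; apply: eq_bigr => i _; rewrite mulr_sumr.
rewrite big_ord_recr /= big1 ?add0r => [|i _]; last first.
  by rewrite sum_y ?mulr0 //= (leq_ltn_trans _ mN).
rewrite subnn expr0 binn mulr1n mul1r; case: eqP => [->|/eqP h].
  by under eq_bigr => k _ do rewrite yN; rewrite sumr_const card_ord mul1r mulr_natl.
by rewrite sum_y ?mul0r //= ltn_neqAle h.
Qed.

(* With z Y = 1 + z this is the recurrence of the Taylor coefficients at 0 of
   (1 + z) / (1 + z - z (1 + t / N) ^ N), whose poles are t = N (y k - 1). *)
Lemma pole_sum_rec n : (n < N)%N ->
  Y * pole_sum n - \sum_(j < n.+1) pole_sum j * ('C(N, n - j)%:R / N%:R ^+ (n - j))
  = (n == 0%N)%:R * Y.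
Proof.
move=> nN.
have N0 : (0 < N)%N by apply: leq_trans nN.
pose tau k := N%:R * (y k - 1).
have tau0 k : tau k != 0 by rewrite mulf_neq0 ?y_neq1.
pose c i : F := 'C(N, i)%:R.
(* Y = (y k)^N is expanded around 1, in the same powers of y k - 1 that occur in the poles. *)
have YE k : Y = \sum_(0 <= i < N.+1) c i * (y k - 1) ^+ i.
  rewrite -(yN k) -[y k in LHS](subrK 1) addrC exprDn big_mkord.
  by apply: eq_bigr => i _; rewrite expr1n mul1r mulr_natl.
have convE : \sum_(j < n.+1) pole_sum j * (c (n - j)%N / N%:R ^+ (n - j)) =
    \sum_k y k / tau k ^+ n.+1 * \sum_(0 <= i < n.+1) c i * (y k - 1) ^+ i.
  under eq_bigr => j _ do rewrite mulr_suml.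
  rewrite exchange_big; apply: eq_bigr => k _ /=.
  rewrite big_mkord (reindex_inj rev_ord_inj) /= mulr_sumr.
  apply: eq_bigr => j _; have jn : (j <= n)%N by rewrite -ltnS.
  rewrite subSS subKn //.
  have -> : tau k ^+ n.+1 = tau k ^+ (n - j).+1 * tau k ^+ j.
    by rewrite -exprD addSn subnK.
  rewrite -/(tau k) invfM -!mulrA; congr (_ * (_ * _)).
  rewrite mulrCA; congr (_ * _).
  by rewrite {1}/tau exprMn invfM -mulrA mulVf ?mulr1 // expf_neq0.
rewrite convE {convE} /pole_sum mulr_sumr -sumrB.
(* The powers i <= n cancel against the convolution. In the others the division by the pole leaves
   (y k - 1)^(i - n - 1), so by [sum_y_subX] only i = N with n = 0 contributes. *)
transitivity (\sum_(n.+1 <= i < N.+1) c i / N%:R ^+ n.+1 *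
   \sum_k y k * (y k - 1) ^+ (i - n.+1)).
  under [RHS]eq_bigr => i _ do rewrite mulr_sumr.
  rewrite exchange_big; apply: eq_bigr => k _ /=.
  rewrite mulrC -mulrBr {1}(YE k) (big_cat_nat (leq0n n.+1)) /=; last exact: leq_trans nN _.
  rewrite addrAC subrr add0r mulr_sumr [LHS]big_nat [RHS]big_nat.
  apply: eq_bigr => i /andP[ni iN].
  have -> : (y k - 1) ^+ i = (y k - 1) ^+ (i - n.+1) * (y k - 1) ^+ n.+1.
    by rewrite -exprD subnK.
  have B0 : (y k - 1) ^+ n.+1 != 0 by rewrite expf_neq0.
  have M0 : N%:R ^+ n.+1 != 0 :> F by rewrite expf_neq0.
  rewrite exprMn; move: (_ ^+ n.+1) (_ ^+ n.+1) (_ ^+ (i - n.+1)) B0 M0 => B M A B0 M0.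
  by field; rewrite M0 B0.
rewrite big_nat_recr //= big_nat big1 ?add0r => [|i /andP[ni iN]]; last first.
  rewrite sum_y_subX; last by rewrite (leq_ltn_trans (leq_subr _ _)).
  rewrite -subSn // subSS (ltn_eqF (leq_ltn_trans (leq_subr _ _) iN)).
  by rewrite mul0r mulr0.
rewrite sum_y_subX; last by rewrite ltn_subrL.
rewrite -subSn // subSS /c binn.
case: n nN => [|n] nN /=; first by rewrite subn0 eqxx expr1 !mul1r mulKf.
by rewrite ltn_eqF ?ltn_subrL // !mul0r mulr0.
Qed.
End PartialFractions.

(** * The poles of the N-th approximation and the non-dominant remainder *)

Section Poles.
Local Open Scope complex_scope.
Import ComplexField.Normc.
Local Notation Re := (@complex.Re _).
Local Notation Im := (@complex.Im _).
Variable R : realType.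
Implicit Types (q a : R) (N k n : nat).

Definition cis a : R[i] := cos a +i* sin a.

Lemma cisD a b : cis (a + b) = cis a * cis b.
Proof. by rewrite /cis cosD sinD; congr (_ +i* _); rewrite /=; ring. Qed.

Lemma cisX a n : cis a ^+ n = cis (a * n%:R).
Proof.
elim: n => [|n IH]; first by rewrite mulr0 /cis cos0 sin0.
by rewrite exprSr IH -cisD; congr cis; rewrite -natr1; ring.
Qed.

Lemma cis_odd_pi k : cis ((2 * k + 1)%:R * pi) = -1.
Proof.
elim: k => [|k IH].
  by rewrite muln0 add0n mul1r /cis cospi sinpi; apply/eqP; rewrite eq_complex /= oppr0 !eqxx.
rewrite (_ : (2 * k.+1 + 1)%:R * pi = (2 * k + 1)%:R * pi + pi *+ 2); last first.
  by rewrite !natrD !natrM -[k.+1%:R]natr1; ring.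
by rewrite cisD IH /cis cos2pi sin2pi mulr1.
Qed.

Lemma cis_neq1 a : 0 < a < pi *+ 2 -> cis a != 1.
Proof.
move=> /andP[a0 a2]; apply/eqP => -[] ca _.
have s0 : 0 < sin (a / 2).
  by apply: sin_gt0_pi; rewrite divr_gt0 //= ltr_pdivrMr // mulr_natr.
have : cos ((a / 2) *+ 2) = 1 by rewrite -mulr_natr divfK.
by rewrite cos_mulr2n cos2sin2 => h; nra.
Qed.

Definition ang N k : R := (2 * k + 1)%:R * pi / N%:R.

(** These are the N-th roots of - e^q, which is the value of (1 + z) / z at z = -1 / (1 + e^q). *)
Definition pole_exp q N k : R[i] := (expR (q / N%:R))%:C * cis (ang N k).

(* The N solutions t of (1 + t / N) ^ N = - e ^ q. *)
Definition pole q N k : R[i] := N%:R * (pole_exp q N k - 1).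

Let NR N : (N%:R : R[i]) = (N%:R : R)%:C. Proof. by rewrite rmorph_nat. Qed.

Lemma pole_expX q N k l :
  pole_exp q N k ^+ l = (expR (q * l%:R / N%:R))%:C * cis (ang N k * l%:R).
Proof.
rewrite exprMn cisX -rmorphXn /= -expRM_natr.
by congr ((expR _)%:C * _); rewrite mulrAC.
Qed.

Lemma pole_expN q N k : (0 < N)%N -> pole_exp q N k ^+ N = - (expR q)%:C.
Proof.
move=> N0; have N1 : N%:R != 0 :> R by rewrite pnatr_eq0 -lt0n.
by rewrite pole_expX mulfK // /ang mulfVK // cis_odd_pi mulrN1.
Qed.

Lemma sum_pole_exp q N l : (0 < l < N)%N ->
  \sum_(k < N) pole_exp q N k ^+ l = 0.
Proof.
move=> /andP[l0 lN]; have N0 : (0 < N)%N by exact: leq_trans lN.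
have N1 : N%:R != 0 :> R by rewrite pnatr_eq0 -lt0n.
have Np : 0 < N%:R :> R by rewrite ltr0n.
pose w := cis (2 * pi / N%:R).
have E k : pole_exp q N k = pole_exp q N 0 * w ^+ k.
  rewrite /pole_exp -mulrA cisX -cisD; congr (_ * cis _).
  by rewrite /ang muln0 add0n natrD natrM; field.
under eq_bigr => k _ do rewrite E exprMn exprAC.
rewrite -mulr_sumr; apply/eqP; rewrite mulf_eq0; apply/orP; right.
have wl : w ^+ l - 1 != 0.
  rewrite subr_eq0 cisX; apply: cis_neq1.
  rewrite !mulr_gt0 ?pi_gt0 ?invr_gt0 ?ltr0n //=.
  rewrite mulrAC ltr_pdivrMr // -[pi *+ 2]mulr_natl.
  by rewrite ltr_pM2l ?ltr_nat // mulr_gt0 ?pi_gt0.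
rewrite -(mulrI_eq0 _ (mulfI wl)) -subrX1 -exprM mulnC exprM cisX.
rewrite mulfVK // (_ : 2 * pi = 0 + pi *+ 2); last by rewrite mulr_natl add0r.
by rewrite /cis cosD2pi sinD2pi cos0 sin0 expr1n subrr.
Qed.

Definition psum q N n := @pole_sum _ N (fun k : 'I_N => pole_exp q N k) n.

Lemma psum_rec q N n : (n < N)%N ->
  - (expR q)%:C * psum q N n
  - \sum_(j < n.+1) psum q N j * ('C(N, n - j)%:R / N%:R ^+ (n - j))
  = - ((n == 0%N)%:R * (expR q)%:C).
Proof.
move=> nN; have N0 : (0 < N)%N by exact: leq_trans nN.
rewrite -mulrN; apply: pole_sum_rec => //.
- by rewrite pnatr_eq0 -lt0n.
- by move=> k; apply: pole_expN.
- by apply/eqP => /(congr1 (@complex.Re R)) /= h; have := expR_gt0 q; lra.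
- exact: sum_pole_exp.
Qed.

Lemma Re_pole q N k :
  Re (pole q N k) = N%:R * (expR (q / N%:R) * cos (ang N k) - 1).
Proof. by rewrite /pole NR /pole_exp /cis /= !mul0r !subr0 ?mulr0 ?subr0. Qed.

Lemma Im_pole q N k :
  Im (pole q N k) = N%:R * (expR (q / N%:R) * sin (ang N k)).
Proof. by rewrite /pole NR /pole_exp /cis /= !mul0r !addr0 ?subr0 ?addr0. Qed.

Definition pole_sq q N k : R :=
  N%:R ^+ 2 * (1 - 2 * expR (q / N%:R) * cos (ang N k) + expR (q / N%:R) ^+ 2).

Lemma normc_pole q N k : normc (pole q N k) ^+ 2 = pole_sq q N k.
Proof.
rewrite (_ : normc _ = Num.sqrt (Re (pole q N k) ^+ 2 + Im (pole q N k) ^+ 2)); last first.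
  by case: (pole q N k).
rewrite sqr_sqrtr ?addr_ge0 ?sqr_ge0 // Re_pole Im_pole /pole_sq.
by rewrite !exprMn sin2cos2; ring.
Qed.

(** The binomial coefficients of index 0 and 1, divided by N^0 and N^1, already equal those of e^t.
    So for every N > 1 this is the limit value (1 + z) P_1(z) at z = -1/2. It is the origin of all
    later factors 1/4. *)
Lemma psum0_1 N : (1 < N)%N -> psum 0 N 1 = - 4^-1.
Proof.
move=> N1; have N0 : N%:R != 0 :> R[i] by rewrite pnatr_eq0 -lt0n ltnW.
have := psum_rec 0 N1; have := psum_rec 0 (ltnW N1).
rewrite !big_ord_recl !big_ord0 /= /bump /= !subnn !bin0 !expr0 !divr1 !mulr1 !addr0.
rewrite expR0 subn0 bin1 expr1 divff // mulr1 addn0 => h0 h1.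
have two0 : 2 != 0 :> R[i] by rewrite pnatr_eq0.
move: h0 h1; rewrite rmorph1 => h0 h1.
have e0 : psum 0 N 0 = 2^-1.
  apply: (mulfI two0); rewrite divff //.
  by apply: oppr_inj; rewrite -[1]mul1r -h0; ring.
apply: (mulfI two0).
have -> : 2 * psum 0 N 1 = - psum 0 N 0.
  move: h1; rewrite mul0r oppr0 => h1.
  by apply: subr0_eq; rewrite -[RHS]oppr0 -[in RHS]h1; ring.
by rewrite e0; field.
Qed.

Lemma pole_exp_neq0 q N k : pole_exp q N k != 0.
Proof.
rewrite mulf_neq0 //; first by rewrite fmorph_eq0 gt_eqF ?expR_gt0.
apply/eqP => h; have := congr1 (@normc R) h.
by rewrite /= cos2Dsin2 sqrtr1 expr0n /= addr0 sqrtr0 => /eqP; rewrite oner_eq0.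
Qed.

Lemma pole_neq0 q N k : (0 < N)%N -> pole q N k != 0.
Proof.
move=> N0; rewrite mulf_neq0 ?pnatr_eq0 -?lt0n // subr_eq0; apply/eqP => h.
have := pole_expN q k N0; rewrite h expr1n => /(congr1 (@complex.Re R)) /= h1.
by have := expR_gt0 q; lra.
Qed.

Lemma pole_sq_gt0 q N k : (0 < N)%N -> 0 < pole_sq q N k.
Proof.
move=> N0; rewrite -normc_pole lt_neqAle sqr_ge0 andbT eq_sym expf_eq0 /=.
by apply: contra (pole_neq0 q k N0) => /eqP/eq0_normc ->.
Qed.

Lemma normc_poleE q N k : normc (pole q N k) = Num.sqrt (pole_sq q N k).
Proof.
rewrite -normc_pole sqrtr_sqr ger0_norm //.
by case: (pole q N k) => a b; exact: sqrtr_ge0.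
Qed.

(* For q = 0 the terms of psum q N 1 are the negative reals -1 / |pole|^2. *)
Lemma sum_pole_sq0 N : (1 < N)%N -> \sum_(k < N) (pole_sq 0 N k)^-1 = 4^-1.
Proof.
move=> N1; have := psum0_1 N1; rewrite /psum /pole_sum.
have E (k : 'I_N) : pole_exp 0 N k / (N%:R * (pole_exp 0 N k - 1)) ^+ 2
    = - ((pole_sq 0 N k)^-1)%:C.
  have -> : (N%:R * (pole_exp 0 N k - 1)) ^+ 2 = pole_exp 0 N k * (- pole_sq 0 N k)%:C.
    rewrite NR /pole_exp /pole_sq mul0r expR0 rmorph1 mul1r.
    rewrite /cis expr2; apply/eqP; rewrite eq_complex /=.
    apply/andP; split; apply/eqP; last by ring.
    apply/eqP; rewrite -subr_eq0; apply/eqP.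
    transitivity (N%:R ^+ 2 * (1 - (cos (ang N k) ^+ 2 + sin (ang N k) ^+ 2)) : R).
      by ring.
    by rewrite cos2Dsin2 subrr mulr0.
  by rewrite invfM mulrA mulfV ?pole_exp_neq0 // mul1r rmorphN invrN fmorphV.
under eq_bigr => k _ do rewrite E.
rewrite sumrN -rmorph_sum /= => /oppr_inj h; apply: complexI; rewrite h.
by rewrite fmorphV rmorph_nat.
Qed.

(** The two sides differ by N^2 (e^(q/N) - 1)^2. This reduces sums over the poles for any q to the
    exact sum at q = 0. *)
Lemma pole_sq_ge q N k : expR (q / N%:R) * pole_sq 0 N k <= pole_sq q N k.
Proof.
rewrite /pole_sq mul0r expR0 mulrCA ler_wpM2l ?sqr_ge0 //.
by have := sqr_ge0 (expR (q / N%:R) - 1); nra.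
Qed.

Lemma cos_ang_rev N k : (k < N)%N -> cos (ang N (N.-1 - k)) = cos (ang N k).
Proof.
move=> kN; have N0 : N%:R != 0 :> R by rewrite pnatr_eq0 -lt0n (leq_trans _ kN).
rewrite -cosN -[RHS](cosN) -[RHS]cosD2pi cosN; congr cos.
have E : (2 * (N.-1 - k) + 1)%:R = 2 * N%:R - (2 * k + 1)%:R :> R.
  by rewrite -natrM -natrB; [congr _%:R; lia | lia].
by rewrite /ang E -mulr_natl; field.
Qed.

(** The excluded indices 0 and N - 1 are the dominant conjugate pair. In the upper half plane the
    angles lie in [0, pi], where cos decreases; the lower half is its mirror image. *)
Lemma le_cos_ang N k : (0 < k)%N -> (k.+1 < N)%N -> cos (ang N k) <= cos (ang N 1).
Proof.
have aux j : (0 < j)%N -> (2 * j + 1 <= N)%N -> cos (ang N j) <= cos (ang N 1).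
  move=> j0 jN.
  have N0 : 0 < N%:R :> R by rewrite ltr0n (leq_trans _ jN) // addn1.
  have ang_in i : (2 * i + 1 <= N)%N -> ang N i \in `[0, pi].
    move=> iN; rewrite in_itv /= /ang !mulr_ge0 ?invr_ge0 ?pi_ge0 //=.
    by rewrite ler_pdivrMr // mulrC ler_wpM2l ?pi_ge0 // ler_nat.
  move: j0; rewrite leq_eqVlt => /predU1P[<- //|j1]; apply: ltW.
  rewrite ltr_cos ?ang_in //; last by apply: leq_trans jN; rewrite leq_add2r leq_mul2l ltnW.
  by rewrite /ang ltr_pM2r ?invr_gt0 // ltr_pM2r ?pi_gt0 // ltr_nat ltn_add2r ltn_mul2l.
move=> k0 kN; have [h|h] := leqP (2 * k + 1) N; first exact: aux.
rewrite -cos_ang_rev; last exact: ltnW.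
apply: aux; first by rewrite subn_gt0 -ltnS prednK // (leq_trans _ kN).
by lia.
Qed.

Lemma pole_sq_le q N k : (0 < k)%N -> (k.+1 < N)%N -> pole_sq q N 1 <= pole_sq q N k.
Proof.
move=> k0 kN; rewrite /pole_sq ler_wpM2l ?sqr_ge0 // lerD2r lerD2l lerN2.
by rewrite ler_wpM2l ?mulr_ge0 ?expR_ge0 // le_cos_ang.
Qed.

Lemma normc_ge_normRe (x : R[i]) : `|Re x| <= normc x.
Proof.
by case: x => a b /=; rewrite -sqrtr_sqr; apply: ler_wsqrtr; rewrite lerDl sqr_ge0.
Qed.

Lemma normcX (x : R[i]) n : normc (x ^+ n) = normc x ^+ n.
Proof. by elim: n => [|n IH]; rewrite ?expr0 ?normc1 // !exprS normcM IH. Qed.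

Lemma conjc_pole_exp q N : (0 < N)%N -> pole_exp q N N.-1 = conjc (pole_exp q N 0).
Proof.
move=> N0; have N1 : N%:R != 0 :> R by rewrite pnatr_eq0 -lt0n.
rewrite /pole_exp rmorphM /= oppr0; congr (_ * _).
have -> : ang N N.-1 = - ang N 0 + pi *+ 2.
  rewrite /ang muln0 add0n mul1r.
  have -> : (2 * N.-1 + 1)%:R = 2 * N%:R - 1 :> R.
    by rewrite -natrM -[1]/(1%:R) -natrB; [congr _%:R; lia | lia].
  by rewrite -mulr_natl; field.
by rewrite /cis cosD2pi sinD2pi cosN sinN.
Qed.

Lemma conjc_pole q N : (0 < N)%N -> pole q N N.-1 = conjc (pole q N 0).
Proof.
by move=> N0; rewrite /pole conjc_pole_exp // [RHS]rmorphM [X in _ = _ * X]rmorphB rmorph1 rmorph_nat.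
Qed.

(** The conjugate terms k = 0 and k = N - 1, distinct because N >= 2, add up to the subtracted real
    part. Any other term has modulus e^(q/N) / |pole|^(n+2). Two of these powers, with e^(q/N), are
    absorbed by the sum of value 1/4, and the other n are bounded through pole 1. This is why the
    index is n + 1. *)
Lemma psum_remainder q M n :
  `|Re (psum q M.+2 n.+1) - 2 * Re (pole_exp q M.+2 0 / pole q M.+2 0 ^+ n.+2)|
   <= 4^-1 * (Num.sqrt (pole_sq q M.+2 1))^-1 ^+ n.
Proof.
set N := M.+2; pose T k := pole_exp q N k / pole q N k ^+ n.+2.
have -> : psum q N n.+1 = \sum_(k < N) T k by [].
rewrite big_ord_recl big_ord_recr /=.
have -> : T (bump 0 M) = conjc (T 0%N).
  rewrite /T -[bump 0 M]/(N.-1) conjc_pole_exp // conjc_pole //.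
  by rewrite [RHS]rmorphM [X in _ = _ * X]fmorphV rmorphXn.
have termE k : normc (T k) =
    expR (q / N%:R) * (pole_sq q N k)^-1 * (Num.sqrt (pole_sq q N k))^-1 ^+ n.
  have p0 := pole_sq_gt0 q k (isT : (0 < N)%N).
  rewrite /T normcM normcV normcX normc_poleE -addn2 exprD sqr_sqrtr ?(ltW p0) //.
  rewrite [X in _ / X]mulrC (invfM (pole_sq q N k)) mulrA exprVn; congr (_ * _ * _).
  rewrite /pole_exp normcM /= cos2Dsin2 sqrtr1 mulr1 expr0n addr0 sqrtr_sqr.
  by rewrite ger0_norm ?expR_ge0.
rewrite -/(T 0%N).
have -> : Re (T 0%N + (\sum_(i < M) T (bump 0 i) + conjc (T 0%N))) - 2 * Re (T 0%N) =
   \sum_(i < M) Re (T (bump 0 i)).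
  have ReD (u v : R[i]) : Re (u + v) = Re u + Re v by case: u; case: v.
  rewrite !ReD (big_morph _ ReD (erefl : Re 0 = 0)) /=.
  by case: (T 0%N) => a b /=; ring.
apply: le_trans (ler_norm_sum _ _ _) _.
rewrite -(@sum_pole_sq0 N) // big_ord_recl big_ord_recr /=.
apply: (@le_trans _ _ (\sum_(i < M) (pole_sq 0 N (bump 0 i))^-1 * (Num.sqrt (pole_sq q N 1))^-1 ^+ n)).
  apply: ler_sum => i _.
  apply: le_trans (normc_ge_normRe _) _; rewrite termE.
  have p0 r k : 0 < pole_sq r N k by exact: pole_sq_gt0.
  have s0 k : 0 < Num.sqrt (pole_sq q N k) by rewrite sqrtr_gt0.
  apply: ler_pM.
  - by rewrite mulr_ge0 ?expR_ge0 // invr_ge0 ltW.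
  - by rewrite exprn_ge0 // invr_ge0 ltW.
  - by rewrite ler_pdivrMr // ler_pdivlMl // [leLHS]mulrC pole_sq_ge.
  - apply: lerXn2r; rewrite ?nnegrE ?invr_ge0 ?sqrtr_ge0 // lef_pV2 ?posrE //.
    apply: ler_wsqrtr; apply: pole_sq_le => //=.
    by rewrite /bump /= add1n !ltnS.
rewrite -mulr_suml ler_wpM2r ?exprn_ge0 ?invr_ge0 ?sqrtr_ge0 //.
by apply: ler_wpDl; rewrite ?lerDl invr_ge0 ltW // pole_sq_gt0.
Qed.
End Poles.

(** * Passage to the limit *)

Section PoleLimit.
Local Open Scope complex_scope.
Import ComplexField.Normc.
Local Notation Re := (@complex.Re _).
Local Notation Im := (@complex.Im _).
Variable R : realType.
Implicit Types (q a : R) (M k n : nat).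

Lemma cvg_inv_shift2 : (fun M => M.+2%:R^-1 : R) @ \oo --> (0 : R).
Proof. by have := @cvg_harmonic R; rewrite -cvg_shiftS. Qed.

Lemma cvg_inv_shift2_dnbhs : (fun M => M.+2%:R^-1 : R) @ \oo --> (0 : R)^'.
Proof.
move=> A A0; have : \forall M \near \oo, (M.+2%:R^-1 : R) != 0 -> A (M.+2%:R^-1).
  exact: cvg_inv_shift2 A0.
by apply: filterS => M; apply; rewrite invr_eq0 pnatr_eq0.
Qed.

(* The coefficients of (1 + t / N) ^ N tend to those of e ^ t. *)
Lemma cvg_bin_div_expn i :
  (fun M => 'C(M.+2, i)%:R / M.+2%:R ^+ i : R) @ \oo --> (i`!%:R^-1 : R).
Proof.
elim: i => [|i IH].
  apply: cvg_near_cst; apply: nearW => M.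
  by rewrite bin0 expr0 divr1 fact0 invr1.
have -> : (i.+1`!%:R^-1 : R) = i`!%:R^-1 * ((1 - i%:R * 0) / i.+1%:R).
  by rewrite mulr0 subr0 mul1r factS natrM invfM mulrC.
have h : (fun M => ('C(M.+2, i)%:R / M.+2%:R ^+ i) * ((1 - i%:R * M.+2%:R^-1) / i.+1%:R) : R)
    @ \oo --> (i`!%:R^-1 * ((1 - i%:R * 0) / i.+1%:R) : R).
  apply: cvgM => //; apply: cvgMl; apply: cvgB; first exact: cvg_cst.
  by apply: cvgMr; exact: cvg_inv_shift2.
apply: cvg_trans h; apply: near_eq_cvg; near=> M.
have iM : (i <= M.+2)%N by apply: leq_trans (_ : M <= _)%N; [near: M; exists i | rewrite -addn2 leq_addr].
have := mul_bin_left M.+2 i => /(congr1 (fun n => n%:R : R)).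
rewrite !natrM natrB // => h'.
have M0 : M.+2%:R != 0 :> R by rewrite pnatr_eq0.
have i0 : i.+1%:R != 0 :> R by rewrite pnatr_eq0.
apply: esym; apply: (mulfI i0); rewrite mulrA h' exprS.
move: (i.+1%:R : R) (M.+2%:R : R) i0 M0 => k m k0 m0; field.
by rewrite k0 m0 expf_neq0.
Unshelve. all: by end_near. Qed.

(** Both sequences are determined by their recurrences. Solving that of [psum] for its last term
    divides by 1 + e^q, which produces the factors z and 1 + z; then strong induction passes to the
    limit. *)
Lemma cvg_psum q (c : nat -> R) n :
  let z := - (1 + expR q)^-1 in
  (forall m, c m = (1 + z) * (m == 0%N)%:R + z * \sum_(j < m) c j / (m - j)`!%:R) ->
  (fun M => Re (psum q M.+2 n)) @ \oo --> c n.
Proof.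
move=> z crec; elim/ltn_ind: n => n IH; rewrite crec.
have e0 : 1 + expR q != 0 by rewrite gt_eqF // addr_gt0 ?expR_gt0.
have h : (fun M => (1 + z) * (n == 0%N)%:R +
     z * \sum_(j < n) Re (psum q M.+2 j) * ('C(M.+2, n - j)%:R / M.+2%:R ^+ (n - j)))
   @ \oo --> (1 + z) * (n == 0%N)%:R + z * \sum_(j < n) c j * (n - j)`!%:R^-1.
  apply: cvgD; first exact: cvg_cst.
  apply: cvgMr; apply: cvg_big => [|j _]; first exact: add_continuous.
  by apply: cvgM; [exact: IH | exact: cvg_bin_div_expn].
apply: cvg_trans h; apply: near_eq_cvg; near=> M.
have nM : (n < M.+2)%N by apply: ltn_trans (_ : M.+1 < _)%N => //; rewrite ltnS; near: M; exists n.
have := congr1 Re (psum_rec q nM).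
have ReD (u v : R[i]) : Re (u + v) = Re u + Re v by case: u; case: v.
have ReN (u : R[i]) : Re (- u) = - Re u by case: u.
have ReM (u : R[i]) (r : R) : Re (u * r%:C) = Re u * r.
  by case: u => x y; rewrite /= mulr0 subr0.
rewrite ReD ReN (big_morph _ ReD (erefl : Re 0 = 0)) /= big_ord_recr /=.
rewrite subnn bin0 expr0 divr1 mulr1.
under eq_bigr => i _.
  rewrite (_ : 'C(M.+2, n - i)%:R / _ = ('C(M.+2, n - i)%:R / M.+2%:R ^+ (n - i) : R)%:C); last first.
    by rewrite rmorphM fmorphV rmorphXn !rmorph_nat.
  rewrite ReM; over.
rewrite [_ * psum _ _ _]mulrC -rmorphN ReM ReN.
rewrite (_ : Re ((n == 0%N)%:R * (expR q)%:C) = (n == 0%N)%:R * expR q); last first.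
  by rewrite -(rmorph_nat (real_complex R)) mulrC ReM mulrC.
move=> h'; apply: (mulfI e0).
set S := \sum_(_ < _) _ in h' *; set s := Re _ in h' *.
have -> : (1 + expR q) * s = (n == 0%N)%:R * expR q - S.
  by apply/eqP; rewrite -subr_eq0 opprB; apply/eqP; move: h'; lra.
by rewrite /z; field.
Unshelve. all: by end_near. Qed.

(** Convergence of complex numbers is taken componentwise, so that only limits of real sequences
    occur. *)
Definition ccvg (u : nat -> R[i]) (l : R[i]) :=
  (fun M => Re (u M)) @ \oo --> Re l /\ (fun M => Im (u M)) @ \oo --> Im l.

Lemma ccvgM u v (a b : R[i]) : ccvg u a -> ccvg v b -> ccvg (fun M => u M * v M) (a * b).
Proof.
move=> [ua1 ua2] [vb1 vb2]; split.
  rewrite (_ : Re (a * b) = Re a * Re b - Im a * Im b); last by case: a {ua1 ua2}; case: b {vb1 vb2}.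
  rewrite (_ : (fun M => _) = fun M => Re (u M) * Re (v M) - Im (u M) * Im (v M)).
    by apply: cvgB; apply: cvgM.
  by apply/funext => M; case: (u M); case: (v M).
rewrite (_ : Im (a * b) = Re a * Im b + Im a * Re b); last by case: a {ua1 ua2}; case: b {vb1 vb2}.
rewrite (_ : (fun M => _) = fun M => Re (u M) * Im (v M) + Im (u M) * Re (v M)).
  by apply: cvgD; apply: cvgM.
by apply/funext => M; case: (u M); case: (v M).
Qed.

Lemma ccvgX u (a : R[i]) n : ccvg u a -> ccvg (fun M => u M ^+ n) (a ^+ n).
Proof.
move=> ua; elim: n => [|n IH].
  by split; rewrite expr0; exact: cvg_cst.
rewrite exprS (_ : (fun M => _) = fun M => u M * u M ^+ n); first exact: ccvgM.
by apply/funext => M; rewrite exprS.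
Qed.

Lemma ccvgV u (a : R[i]) : a != 0 -> ccvg u a -> ccvg (fun M => (u M)^-1) a^-1.
Proof.
move=> a0 [ua1 ua2].
have n0 : Re a ^+ 2 + Im a ^+ 2 != 0.
  apply: contra a0; rewrite paddr_eq0 ?sqr_ge0 // !expf_eq0 /=.
  by rewrite eq_complex.
have hn : (fun M => (Re (u M) ^+ 2 + Im (u M) ^+ 2)^-1) @ \oo --> (Re a ^+ 2 + Im a ^+ 2)^-1.
  by apply: cvgV => //; apply: cvgD; rewrite expr2; apply: cvgM.
split.
  rewrite (_ : Re a^-1 = Re a * (Re a ^+ 2 + Im a ^+ 2)^-1); last by case: a {ua1 ua2 a0 n0 hn}.
  rewrite (_ : (fun M => _) = fun M => Re (u M) * (Re (u M) ^+ 2 + Im (u M) ^+ 2)^-1).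
    exact: cvgM.
  by apply/funext => M; case: (u M).
rewrite (_ : Im a^-1 = - (Im a * (Re a ^+ 2 + Im a ^+ 2)^-1)); last first.
  by case: a {ua1 ua2 a0 n0 hn} => x y /=; rewrite ?mulNr.
rewrite (_ : (fun M => _) = fun M => - (Im (u M) * (Re (u M) ^+ 2 + Im (u M) ^+ 2)^-1)).
  by apply: cvgN; apply: cvgM.
by apply/funext => M; case: (u M) => x y /=; rewrite ?mulNr.
Qed.

Lemma cvg_diff_quotient (f : R -> R) (d : R) : is_derive (0 : R) 1 f d ->
  (fun M => M.+2%:R * (f M.+2%:R^-1 - f 0)) @ \oo --> d.
Proof.
move=> [df fd]; rewrite -fd.
have h : (fun h : R => h^-1 *: (f (h *: 1 + 0) - f 0)) @ 0^' --> 'D_1 f 0 by exact: df.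
have := cvg_comp _ _ cvg_inv_shift2_dnbhs h.
apply: cvg_trans; apply: near_eq_cvg; apply: nearW => M /=.
by rewrite invrK addr0 [_ *: 1]mulr1.
Qed.

(** With b = (2 k + 1) pi, the real and imaginary parts of N (e^((q + i b) / N) - 1) are difference
    quotients at 0, with step 1 / N, of e^(q t) cos (b t) and e^(q t) sin (b t). *)
Lemma cvg_pole q k : ccvg (fun M => pole q M.+2 k) (q +i* ((2 * k + 1)%:R * pi)).
Proof.
set b := (2 * k + 1)%:R * pi.
have angE M : ang R M.+2 k = b * M.+2%:R^-1 by [].
split.
  have h : is_derive (0 : R) 1 (fun t => expR (q * t) * cos (b * t)) q.
    apply: is_derive_eq; rewrite !mulr0 expR0 cos0 sin0 /GRing.scale /=; ring.
  have := cvg_diff_quotient h; apply: cvg_trans; apply: near_eq_cvg.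
  by apply: nearW => M /=; rewrite Re_pole angE !mulr0 expR0 cos0 mulr1.
have h : is_derive (0 : R) 1 (fun t => expR (q * t) * sin (b * t)) b.
  apply: is_derive_eq; rewrite !mulr0 expR0 cos0 sin0 /GRing.scale /=; ring.
have := cvg_diff_quotient h; apply: cvg_trans; apply: near_eq_cvg.
by apply: nearW => M /=; rewrite Im_pole angE !mulr0 sin0 mulr0 subr0.
Qed.

Lemma cvg_pole_exp q k : ccvg (fun M => pole_exp q M.+2 k) 1.
Proof.
have eE M : pole_exp q M.+2 k = 1 + (M.+2%:R^-1)%:C * pole q M.+2 k.
  rewrite /pole mulrA fmorphV rmorph_nat mulVf ?mul1r ?pnatr_eq0 //.
  by rewrite addrC subrK.
have h : ccvg (fun M => (M.+2%:R^-1)%:C * pole q M.+2 k)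
    (0%:C * (q +i* ((2 * k + 1)%:R * pi))).
  by apply: ccvgM (cvg_pole q k); split; [exact: cvg_inv_shift2 | exact: cvg_cst].
rewrite rmorph0 mul0r in h; case: h => h1 h2.
split.
  rewrite -[Re 1]addr0 (_ : (fun M => _) = fun M => 1 + Re ((M.+2%:R^-1)%:C * pole q M.+2 k)).
    by apply: cvgD => //; exact: cvg_cst.
  by apply/funext => M; rewrite eE; case: (_ * _).
rewrite -[Im 1]addr0 (_ : (fun M => _) = fun M => 0 + Im ((M.+2%:R^-1)%:C * pole q M.+2 k)).
  by apply: cvgD => //; exact: cvg_cst.
by apply/funext => M; rewrite eE; case: (_ * _).
Qed.

(** This is the limit of [psum_remainder] for fixed n: the poles 0 and 1 tend to q + i pi and q + 3
    i pi. *)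
Lemma gcoef_pole_bound (P : nat -> {poly R}) q z n :
  geometric_polys P -> z = - (1 + expR q)^-1 ->
  `|(1 + z) * gcoef P z n.+1 - 2 * Re ((q +i* pi)^-1 ^+ n.+2)|
    <= 4^-1 * (Num.sqrt (q ^+ 2 + (3 * pi) ^+ 2))^-1 ^+ n.
Proof.
move=> P_geom zE.
have p0 : 0 < pi :> R by exact: pi_gt0.
have h1 : (fun M => Re (psum q M.+2 n.+1)) @ \oo --> (1 + z) * gcoef P z n.+1.
  apply: (cvg_psum (c := fun m => (1 + z) * gcoef P z m)) => m; rewrite -zE.
  rewrite (gcoef_lin P_geom) mulrDr mulrCA mulr_sumr; congr (_ + _ * _).
  by apply: eq_bigr => i _; rewrite mulrA.
have h2 : (fun M => Re (pole_exp q M.+2 0 / pole q M.+2 0 ^+ n.+2)) @ \oo -->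
    Re ((q +i* pi)^-1 ^+ n.+2).
  have p1 : q +i* pi != 0 by rewrite eq_complex /= (gt_eqF p0) andbF.
  have hp := cvg_pole q 0; rewrite muln0 add0n mul1r in hp.
  have [+ _] := ccvgM (cvg_pole_exp q 0) (ccvgX n.+2 (ccvgV p1 hp)).
  rewrite mul1r; apply: cvg_trans; apply: near_eq_cvg; apply: nearW => M /=.
  by rewrite exprVn.
have h3 : (fun M => pole_sq q M.+2 1) @ \oo --> q ^+ 2 + (3 * pi) ^+ 2.
  have [hr hi] := cvg_pole q 1; rewrite /= muln1 in hr hi.
  have : (fun M => Re (pole q M.+2 1) ^+ 2 + Im (pole q M.+2 1) ^+ 2) @ \oo -->
    q ^+ 2 + (3 * pi) ^+ 2.
    by apply: cvgD; rewrite expr2; apply: cvgM.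
  apply: cvg_trans; apply: near_eq_cvg; apply: nearW => M /=.
  rewrite -normc_pole; case: (pole _ _ _) => x y /=.
  by rewrite sqr_sqrtr // addr_ge0 ?sqr_ge0.
have s0 : Num.sqrt (q ^+ 2 + (3 * pi) ^+ 2) != 0.
  by rewrite gt_eqF // sqrtr_gt0 ltr_wpDl ?sqr_ge0 // exprn_gt0 // mulr_gt0.
have h4 : (fun M => 4^-1 * (Num.sqrt (pole_sq q M.+2 1))^-1 ^+ n) @ \oo -->
    4^-1 * (Num.sqrt (q ^+ 2 + (3 * pi) ^+ 2))^-1 ^+ n.
  apply: cvgMr.
  apply: (@continuous_cvg _ R R _ _ _ (fun x : R => x ^+ n)); first exact: exprn_continuous.
  apply: cvgV => //.
  by apply: (@continuous_cvg _ R R _ _ _ Num.sqrt); first exact: sqrt_continuous.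
have h5 : (fun M => `|Re (psum q M.+2 n.+1) - 2 * Re (pole_exp q M.+2 0 / pole q M.+2 0 ^+ n.+2)|)
   @ \oo --> `|(1 + z) * gcoef P z n.+1 - 2 * Re ((q +i* pi)^-1 ^+ n.+2)|.
  by apply: cvg_norm; apply: cvgB => //; apply: cvgMr.
by apply: (ler_cvg_to h5 h4); apply: nearW => M; exact: psum_remainder.
Qed.

(** Since tan phi = q / pi, the pole q + i pi has modulus pi / cos phi and argument pi / 2 - phi. *)
Lemma Re_pole_polar q n : let phi := atan (q / pi) in
  Re ((q +i* pi)^-1 ^+ n) = (cos phi / pi) ^+ n * cos (n%:R * (pi / 2 - phi)).
Proof.
move=> phi.
have p0 : 0 < pi :> R by exact: pi_gt0.
have c0 : 0 < cos phi by rewrite cos_gt0_pihalf // atan_gtNpi2 atan_ltpi2.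
have p1 : q +i* pi != 0 by rewrite eq_complex /= (gt_eqF p0) andbF.
have tanE : sin phi = cos phi * (q / pi).
  by rewrite -[in RHS](atanK (q / pi)) -/phi /tan mulrC divfK ?gt_eqF.
have -> : (q +i* pi)^-1 = (cos phi / pi)%:C * cis (- (pi / 2 - phi)).
  apply: (mulfI p1); rewrite divff // /cis cosN sinN.
  rewrite cosB sinB cos_pihalf sin_pihalf.
  have := cos2Dsin2 phi; move: p0 tanE; clearbody phi.
  move: (cos phi) (sin phi) (pi : R) => c s p p0 -> cs.
  have pn : p != 0 by rewrite gt_eqF.
  apply/eqP; rewrite eq_complex /=; apply/andP; split; apply/eqP; last by field.
  by rewrite -[LHS]cs; field.
by rewrite exprMn cisX -rmorphXn /cis /= mul0r subr0 mulNr cosN [_ * n%:R]mulrC.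
Qed.

End PoleLimit.

(** * The angle of a zero *)

Section Angle.
Variable R : realType.
Implicit Types (x y z a : R).

Definition logit z := ln (1 + z) - ln (- z).
Definition angle z := atan (logit z / pi).

Lemma expR_logit z : -1 < z < 0 -> expR (logit z) = (1 + z) / - z.
Proof.
move=> /andP[z1 z0]; rewrite expRD expRN !lnK // posrE; last by lra.
lra.
Qed.

Lemma logitK z : -1 < z < 0 -> - (1 + expR (logit z))^-1 = z.
Proof.
move=> zi; rewrite expR_logit //; have z0 : z != 0 by move: zi; case: eqP => // ->; lra.
have -> : 1 + (1 + z) / - z = - z^-1 by field.
by rewrite invrN opprK invrK.
Qed.

Lemma logit_symm z : logit (-1 - z) = - logit z.
Proof.
rewrite /logit (_ : 1 + (-1 - z) = - z); last by ring.
by rewrite (_ : - (-1 - z) = 1 + z) ?opprB; last by ring.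
Qed.

Lemma angle_symm z : angle (-1 - z) = - angle z.
Proof. by rewrite /angle logit_symm mulNr atanN. Qed.

Lemma angle_half : angle (- 2^-1) = 0.
Proof.
rewrite /angle /logit opprK (_ : 1 - 2^-1 = 2^-1); last by field.
by rewrite subrr mul0r atan0.
Qed.

Lemma angle_ltpi2 z : angle z < pi / 2. Proof. exact: atan_ltpi2. Qed.
Lemma angle_gtNpi2 z : - (pi / 2) < angle z. Proof. exact: atan_gtNpi2. Qed.

Lemma le_sinh x : 0 <= x -> 2 * x <= expR x - expR (- x).
Proof.
rewrite le_eqVlt => /predU1P[<-|x0]; first by rewrite oppr0 subrr mulr0.
pose f t : R := expR t - expR (- t) - 2 * t.
pose df t : R := expR t + expR (- t) - 2.
have fd (t : R) : is_derive t 1 f (df t).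
  by apply: is_derive_eq; rewrite /df /GRing.scale /=; ring.
have [c _ h] := @MVT R f df 0 x x0 (fun t _ => fd t)
  (derivable_within_continuous (fun t _ => @ex_derive _ _ _ _ _ _ _ (fd t))).
have : 0 <= df c.
  have e1 := expR_gt0 c; have : expR c * expR (- c) = 1 by exact: expRxMexpNx_1.
  have := sqr_ge0 (expR c - 1); rewrite /df; move: (expR c) (expR (- c)) e1 => u v; nra.
move: h; rewrite /f oppr0 expR0; nra.
Qed.

(* Since - z (1 + z) = 1 / (4 cosh(q / 2) ^ 2) for q = logit z, this follows from
   cosh(q / 2) ^ 2 >= 1 + (q / 2) ^ 2 and pi >= 2. *)
Lemma logit_mul_le z : -1 < z < 0 ->
  (1 + (logit z / pi) ^+ 2) * (- z * (1 + z)) <= 4^-1.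
Proof.
move=> zi; set q := logit z; pose u := expR (q / 2).
have u0 : 0 < u by exact: expR_gt0.
have eq : expR q = u ^+ 2.
  by rewrite /u expr2 -expRD -splitr.
have qu : q ^+ 2 <= (u - u^-1) ^+ 2.
  have aux (t : R) : 0 <= t -> t ^+ 2 <= (expR (t / 2) - (expR (t / 2))^-1) ^+ 2.
    move=> t0; rewrite -expRN; have := @le_sinh (t / 2); rewrite divr_ge0 // => /(_ isT).
    by rewrite mulrC divfK // => h; rewrite ler_sqr ?nnegrE //; lra.
  have [q0|q0] := leP 0 q; first exact: aux.
  have := aux (- q); rewrite oppr_ge0 ltW // => /(_ isT).
  by rewrite sqrrN mulNr expRN invrK -[X in _ <= X]sqrrN opprB.
have qp : (q / pi) ^+ 2 <= 4^-1 * q ^+ 2.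
  rewrite expr_div_n mulrC ler_wpM2r ?sqr_ge0 //.
  have p2 := pi_ge2 R; rewrite -exprVn -(_ : 2^-1 ^+ 2 = 4^-1); last by field.
  by rewrite ler_sqr ?nnegrE ?invr_ge0 ?pi_ge0 // lef_pV2 ?posrE ?pi_gt0.
have zE : z = - (1 + u ^+ 2)^-1 by rewrite -eq logitK.
have u2 : 0 < 1 + u ^+ 2 by rewrite addr_gt0 ?exprn_gt0.
have -> : - z * (1 + z) = u ^+ 2 / (1 + u ^+ 2) ^+ 2.
  by rewrite zE; field; rewrite gt_eqF.
rewrite mulrA ler_pdivrMr ?exprn_gt0 //.
have e1 : 4^-1 * (u - u^-1) ^+ 2 * u ^+ 2 = 4^-1 * (u ^+ 2 - 1) ^+ 2.
  by field; rewrite gt_eqF.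
have : (q / pi) ^+ 2 * u ^+ 2 <= 4^-1 * (u ^+ 2 - 1) ^+ 2.
  rewrite -e1 ler_wpM2r ?sqr_ge0 //; apply: le_trans qp _.
  by rewrite ler_wpM2l.
move: ((q / pi) ^+ 2) (u ^+ 2) => A B; nra.
Qed.

Definition dangle z := ((1 + (logit z / pi) ^+ 2) * (- z * (1 + z)) * pi)^-1.

Lemma is_derive_angle z : -1 < z < 0 -> is_derive z 1 angle (dangle z).
Proof.
move=> /andP[z1 z0].
have h1 : is_derive z 1 logit ((1 + z)^-1 + (- z)^-1).
  have d1 : is_derive (1 + z) 1 (@ln R) (1 + z)^-1 by apply: is_derive1_ln; lra.
  have d2 : is_derive (- z) 1 (@ln R) (- z)^-1 by apply: is_derive1_ln; lra.
  by apply: is_derive_eq; rewrite /GRing.scale /=; ring.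
have hq : is_derive z 1 (fun t => logit t / pi) (((1 + z)^-1 + (- z)^-1) / pi).
  apply: (is_derive_eq (is_deriveM h1 (is_derive_cst pi^-1 z 1))).
  by rewrite /GRing.scale /= mulr0 add0r mulrC.
have h2 := @is_derive1_comp R atan _ _ _ _ (is_derive1_atan _) hq.
apply: (is_derive_eq h2); rewrite /dangle.
have q0 : 0 < 1 + (logit z / pi) ^+ 2 by rewrite ltr_wpDr ?sqr_ge0.
move: q0 (pi_gt0 R); move: (1 + (logit z / pi) ^+ 2) => A; move: (pi : R) => p A0 p0.
have An : A != 0 by rewrite gt_eqF.
have pn : p != 0 by rewrite gt_eqF.
have zn : z != 0 by rewrite lt_eqF.
have z1n : 1 + z != 0 by rewrite gt_eqF //; lra.
by field; rewrite An pn zn z1n.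
Qed.

(** Equality holds at z = -1/2, so the zeros are farthest apart there; this is the source of the
    slope pi / 4. *)
Lemma dangle_ge z : -1 < z < 0 -> 4 / pi <= dangle z.
Proof.
move=> zi; have p0 := pi_gt0 R; have h := logit_mul_le zi.
have zz : 0 < - z * (1 + z) by move: zi => /andP[? ?]; rewrite mulr_gt0; lra.
have A0 : 0 < (1 + (logit z / pi) ^+ 2) * (- z * (1 + z)).
  by rewrite mulr_gt0 // ltr_wpDr ?sqr_ge0.
rewrite /dangle invfM ler_wpM2r ?invr_ge0 ?pi_ge0 //.
by rewrite -[4]invrK lef_pV2 ?posrE // invr_gt0.
Qed.

Lemma dangle_le z m : -1 < z < 0 -> 0 < m -> m <= - z * (1 + z) -> dangle z <= (pi * m)^-1.
Proof.
move=> zi m0 mz; have p0 := pi_gt0 R.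
have A1 : 1 <= 1 + (logit z / pi) ^+ 2 by rewrite lerDl sqr_ge0.
have mA : m <= (1 + (logit z / pi) ^+ 2) * (- z * (1 + z)) by nra.
have A0 := lt_le_trans m0 mA.
rewrite /dangle lef_pV2 ?posrE ?(mulr_gt0 A0) ?mulr_gt0 //.
by rewrite [leLHS]mulrC ler_wpM2r // pi_ge0.
Qed.

Lemma angle_MVT x y : -1 < x -> x < y -> y < 0 ->
  exists2 c, x < c < y & angle y - angle x = dangle c * (y - x).
Proof.
move=> x1 xy y0.
have inI c : x <= c -> c <= y -> -1 < c < 0.
  by move=> xc cy; rewrite (lt_le_trans x1 xc) (le_lt_trans cy y0).
have hd (c : R) : c \in `]x, y[ -> is_derive c 1 angle (dangle c).
  by rewrite in_itv /= => /andP[xc cy]; apply/is_derive_angle/inI; exact: ltW.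
have hc : {within `[x, y], continuous angle}.
  apply: derivable_within_continuous => c; rewrite in_itv /= => /andP[xc cy].
  exact: (@ex_derive _ _ _ _ _ _ _ (is_derive_angle (inI c xc cy))).
by have [c] := MVT xy hd hc; rewrite in_itv /=; exists c.
Qed.

Lemma angle_sub_ge x y : -1 < x -> x <= y -> y < 0 -> y - x <= pi / 4 * (angle y - angle x).
Proof.
move=> x1; rewrite le_eqVlt => /predU1P[-> _|xy y0]; first by rewrite !subrr mulr0.
have [c /andP[xc cy] ->] := angle_MVT x1 xy y0.
have ci : -1 < c < 0 by rewrite (lt_trans x1 xc) (lt_trans cy y0).
have p0 := pi_gt0 R; have h := dangle_ge ci.
rewrite mulrA ler_peMl ?subr_ge0 ?(ltW xy) //.
rewrite mulrC -ler_pdivrMr ?divr_gt0 // invf_div mul1r //.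
Qed.

Lemma lt_angle x y : -1 < x -> x < y -> y < 0 -> angle x < angle y.
Proof.
move=> x1 xy y0; have := angle_sub_ge x1 (ltW xy) y0.
have p0 := pi_gt0 R; rewrite -subr_gt0 => h.
have : 0 < pi / 4 * (angle y - angle x) by apply: lt_le_trans h; rewrite subr_gt0.
by rewrite pmulr_rgt0 // divr_gt0.
Qed.

Lemma le_angle x y : -1 < x -> x <= y -> y < 0 -> angle x <= angle y.
Proof.
move=> x1; rewrite le_eqVlt => /predU1P[-> //|xy] y0; exact/ltW/lt_angle.
Qed.

Lemma angle_sub_le x y m : -1 < x -> x <= y -> y < 0 -> 0 < m ->
  m <= - x * (1 + x) -> m <= - y * (1 + y) -> pi * m * (angle y - angle x) <= y - x.
Proof.
move=> x1; rewrite le_eqVlt => /predU1P[-> *|xy y0 m0 mx my]; first by rewrite !subrr mulr0.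
have [c /andP[xc cy] ->] := angle_MVT x1 xy y0.
have ci : -1 < c < 0 by rewrite (lt_trans x1 xc) (lt_trans cy y0).
(* The parabola - c (1 + c) is concave, hence at least its smaller endpoint value; the sign of 1 + x
   + c tells which endpoint to compare with. *)
have mc : m <= - c * (1 + c) by have [h|h] := leP (1 + x + c) 0; nra.
have p0 := pi_gt0 R; have h := dangle_le ci m0 mc.
rewrite mulrA ger_pMl ?subr_gt0 //.
rewrite mulrC -ler_pdivlMr ?mulr_gt0 // mul1r //.
Qed.

Lemma angle_IVT x y v : -1 < x -> x < y -> y < 0 -> angle x < v -> v < angle y ->
  exists2 c, x < c < y & angle c = v.
Proof.
move=> x1 xy y0 xv vy.
have hc : {within `[x, y], continuous angle}.
  apply: derivable_within_continuous => c; rewrite in_itv /= => /andP[xc cy].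
  have ci : -1 < c < 0 by rewrite (lt_le_trans x1 xc) (le_lt_trans cy y0).
  exact: (@ex_derive _ _ _ _ _ _ _ (is_derive_angle ci)).
have hv : Num.min (angle x) (angle y) <= v <= Num.max (angle x) (angle y).
  by rewrite ge_min le_max (ltW xv) (ltW vy) orbT.
have [c] := IVT (ltW xy) hc hv.
rewrite in_itv /= => /andP[xc cy] e; exists c => //.
apply/andP; split; rewrite lt_neqAle ?xc ?cy andbT; apply/eqP => h.
  by move: xv; rewrite -e -h ltxx.
by move: vy; rewrite -e h ltxx.
Qed.

End Angle.

(** * Spacing of the zeros in the bulk *)

Section Roots.
Variables (R : realType) (P : nat -> {poly R}).
Hypothesis P_geom : geometric_polys P.
Implicit Types (x y z a e : R).

Lemma normr_logit_le z a : - 2^-1 < a -> a < 0 -> -1 - a <= z -> z <= a ->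
  `|logit z| <= logit a.
Proof.
move=> a1 a0 az za.
have mono x : -1 < x -> x <= a -> logit x <= logit a.
  by move=> x1 xa; rewrite /logit lerB // ler_ln ?posrE; lra.
rewrite ler_norml mono ?andbT //; last by lra.
by rewrite lerNl -logit_symm mono //; lra.
Qed.

(** [gcoef_pole_bound] is divided by twice |q + i pi|^(-n-2). The quotient of the moduli of the
    first two poles gives the geometric rate, and 1/8 is half of 1/4. *)
Lemma cos_approx_error z n : -1 < z < 0 ->
  exists2 c, 0 < c &
  `|c * (P n.+1).[z] - cos (n.+2%:R * (pi / 2 - angle z))| <=
  8^-1 * (logit z ^+ 2 + pi ^+ 2) *
    Num.sqrt ((logit z ^+ 2 + pi ^+ 2) / (logit z ^+ 2 + (3 * pi) ^+ 2)) ^+ n.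
Proof.
move=> zi; set q := logit z; set phi := angle z.
have p0 := pi_gt0 R.
have c0 : 0 < cos phi by rewrite cos_gt0_pihalf // angle_ltpi2 angle_gtNpi2.
pose X := cos phi / pi; have X0 : 0 < X by rewrite divr_gt0.
have X2 : (X ^+ 2)^-1 = q ^+ 2 + pi ^+ 2.
  rewrite /X expr_div_n invf_div -[_ / cos phi ^+ 2]/(_ * cos phi ^- 2).
  rewrite cos2_tan2 ?gt_eqF // /phi /angle atanK -/q expr_div_n mulrDr mulr1.
  by rewrite addrC mulrCA divff ?mulr1 // expf_neq0 // gt_eqF.
pose D := q ^+ 2 + (3 * pi) ^+ 2.
have D0 : 0 < D by rewrite ltr_wpDl ?sqr_ge0 // exprn_gt0 // mulr_gt0.
have := gcoef_pole_bound n P_geom (esym (logitK zi)).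
rewrite -/q -/D Re_pole_polar -[atan (q / pi)]/phi -/X => h.
have X20 : 0 < X ^+ n.+2 by rewrite exprn_gt0.
exists ((1 + z) / (n.+1`!%:R * (2 * X ^+ n.+2))).
  apply: divr_gt0; first by move: zi => /andP[z1 _]; lra.
  by apply: mulr_gt0; [rewrite ltr0n fact_gt0 | exact: mulr_gt0].
have -> : (1 + z) / (n.+1`!%:R * (2 * X ^+ n.+2)) * (P n.+1).[z] -
    cos (n.+2%:R * (pi / 2 - phi)) =
  ((1 + z) * gcoef P z n.+1 - 2 * (X ^+ n.+2 * cos (n.+2%:R * (pi / 2 - phi)))) / (2 * X ^+ n.+2).
  rewrite /gcoef mulrBl; congr (_ - _); first by rewrite invfM !mulrA; ring.
  by rewrite mulrA mulrAC mulfV ?mul1r // mulf_neq0 ?gt_eqF.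
have D2 : 0 < 2 * X ^+ n.+2 by exact: mulr_gt0.
rewrite normrM normfV (gtr0_norm D2) ler_pdivrMr //.
apply: le_trans h _.
rewrite sqrtrM ?addr_ge0 ?sqr_ge0 // sqrtrV ?(ltW D0) // exprMn -X2.
have -> : Num.sqrt (X ^+ 2)^-1 = X^-1.
  by rewrite -exprVn sqrtr_sqr ger0_norm // invr_ge0 ltW.
rewrite le_eqVlt; apply/orP; left; apply/eqP.
have -> : X ^+ n.+2 = X ^+ 2 * X ^+ n by rewrite -exprD.
have Xn : X ^+ n != 0 by rewrite expf_neq0 // gt_eqF.
have Xn' : X != 0 by rewrite gt_eqF.
rewrite (exprVn X n); move: (_ ^+ n) (X ^+ n) (X) Xn Xn' => A B C B0 C0.
by field; rewrite B0 C0.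
Qed.

(** Both factors of the previous error increase with logit(z)^2, which on the bulk is largest at its
    endpoints. The rate there is below 1, so the approximation is uniform. *)
Lemma cos_approx a e : - 2^-1 < a -> a < 0 -> 0 < e ->
  \forall n \near \oo, forall z, -1 - a <= z -> z <= a ->
  exists2 c, 0 < c &
  `|c * (P n).[z] - cos (n.+1%:R * (pi / 2 - angle z))| <= e.
Proof.
move=> a1 a0 e0; have p0 := pi_gt0 R.
pose Q := logit a ^+ 2; pose r := (Q + pi ^+ 2) / (Q + (3 * pi) ^+ 2).
have Q0 : 0 <= Q by rewrite sqr_ge0.
have pp : 0 < (pi : R) ^+ 2 by rewrite exprn_gt0.
have D0 t : 0 <= t -> 0 < t + (3 * pi) ^+ 2 :> R.
  by move=> t0; rewrite ltr_wpDl // exprn_gt0 // mulr_gt0.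
have r0 : 0 <= r by rewrite divr_ge0 ?addr_ge0 ?sqr_ge0.
have r1 : Num.sqrt r < 1.
  rewrite -sqrtr1 ltr_sqrt // ltr_pdivrMr ?D0 // mul1r exprMn; lra.
have : (fun n => 8^-1 * (Q + pi ^+ 2) * Num.sqrt r ^+ n) @ \oo --> (8^-1 * (Q + pi ^+ 2) * 0 : R).
  by apply: cvgMr; apply: cvg_expr; rewrite ger0_norm ?sqrtr_ge0.
rewrite mulr0 => /cvgr0Pnorm_le/(_ e e0)[N _ hN].
exists N.+1 => // -[//|n] /= Nn z az za.
have zi : -1 < z < 0 by apply/andP; split; lra.
have [c c0 hc] := cos_approx_error n zi; exists c => //; apply: le_trans hc _.
apply: le_trans (hN n Nn).
have qQ : logit z ^+ 2 <= Q.
  rewrite -[logit z ^+ 2]real_normK ?num_real // ler_sqr ?nnegrE ?normr_ge0 //.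
    exact: normr_logit_le.
  by apply: le_trans (normr_logit_le a1 a0 az za).
rewrite ger0_norm ?mulr_ge0 ?addr_ge0 ?Q0 ?sqr_ge0 ?exprn_ge0 ?sqrtr_ge0 //.
have q0 := sqr_ge0 (logit z).
apply: ler_pM; rewrite ?mulr_ge0 ?addr_ge0 ?Q0 ?sqr_ge0 ?exprn_ge0 ?sqrtr_ge0 //.
  by rewrite ler_wpM2l // lerD2r.
apply: lerXn2r; rewrite ?nnegrE ?sqrtr_ge0 //.
apply: ler_wsqrtr; rewrite ler_pdivrMr ?D0 // mulrAC ler_pdivlMr ?D0 //.
move: (logit z ^+ 2) q0 qQ => t t0 tQ; rewrite exprMn.
by move: (pi ^+ 2) pp => u u0; nra.
Qed.

Lemma normr_sinB_le (u v h : R) : `|cos u| <= h -> `|cos v| <= h -> `|sin (u - v)| <= 2 * h.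
Proof.
move=> cu cv; rewrite sinB; apply: le_trans (ler_normB _ _) _.
rewrite !normrM mulr_natl mulr2n; apply: lerD.
  by rewrite -[h]mul1r; apply: ler_pM; rewrite ?sin_max.
by rewrite -[h]mulr1; apply: ler_pM; rewrite ?sin_max.
Qed.

Lemma mulr_lt0_of_approx (c d p q C h : R) : 0 < c -> 0 < d ->
  `|c * p - C| <= h -> `|d * q + C| <= h -> h < `|C| -> p * q < 0.
Proof.
move=> c0 d0; rewrite !ler_norml => /andP[p1 p2] /andP[q1 q2].
have [C0|C0] := ltrP 0 C.
  rewrite (gtr0_norm C0) => hC.
  rewrite pmulr_rlt0; first by rewrite -(pmulr_rlt0 _ d0); lra.
  by rewrite -(pmulr_rgt0 _ c0); lra.
rewrite (ler0_norm C0) => hC.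
rewrite nmulr_rlt0; first by rewrite -(pmulr_rgt0 _ d0); lra.
by rewrite -(pmulr_rlt0 _ c0); lra.
Qed.

(** On [d, pi - e], a part of [d, pi - d], the sine is at least sin d. *)
Lemma lt_of_normr_sin_lt (d e v : R) : 0 < d -> d <= e -> d <= 1 -> 0 <= v ->
  v <= pi - e -> `|sin v| < sin d -> v < d.
Proof.
move=> d0 de d1 v0 ve sv; have p2 := pi_ge2 R.
rewrite ltNge; apply/negP => dv; move: sv; apply/negP; rewrite -leNgt.
apply: le_trans (ler_norm _).
have [le2|gt2] := leP v (pi / 2).
  move: dv; rewrite le_eqVlt => /predU1P[-> //|dv].
  by apply/ltW; rewrite ltr_sin // in_itv /=; lra.
have -> : sin v = sin (pi - v) by rewrite sinB sinpi cospi mul0r mulN1r sub0r opprK.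
move: de; rewrite le_eqVlt => /predU1P[dE|de].
  move: ve; rewrite -dE le_eqVlt => /predU1P[->|ve].
    by rewrite opprB addrC subrK.
  by apply/ltW; rewrite ltr_sin ?in_itv /=; lra.
by apply/ltW; rewrite ltr_sin ?in_itv /=; lra.
Qed.

Lemma normr_cosB_le (d u v : R) : 0 <= v -> v < d -> d <= 1 ->
  `|cos (u - v)| <= `|cos u| + sin d.
Proof.
move=> v0 vd d1; have p2 := pi_ge2 R.
have sv : `|sin v| <= sin d.
  rewrite ger0_norm; last by apply: sin_ge0_pi; lra.
  by apply/ltW; rewrite ltr_sin ?in_itv /=; lra.
rewrite cosB; apply: le_trans (ler_normD _ _) _; rewrite !normrM.
apply: lerD; first by rewrite ler_piMr // cos_max.
by apply: le_trans sv; rewrite ler_piMl // sin_max.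
Qed.

(** If cos w is small then |sin w| is nearly 1, so cos (w + t) is nearly sin t up to sign and cannot
    be small. In numbers, |sin w| < 1/2 and |cos w| < 1/3 contradict the Pythagorean identity. *)
Lemma cos_rotation_neq (k s t w : R) : 0 < s -> 6 * s < k -> k <= 1 -> k <= sin t ->
  `|cos w| <= 2 * s -> `|cos (w + t)| <= s -> False.
Proof.
move=> s0 sk k1 kt cw cwt.
have key : sin t * sin w = cos w * cos t - cos (w + t) by rewrite cosD; ring.
have : `|sin t * sin w| <= 3 * s.
  rewrite key; apply: le_trans (ler_normB _ _) _; rewrite normrM.
  have : `|cos w| * `|cos t| <= `|cos w| by rewrite ler_piMr // cos_max.
  by move: cw cwt; lra.
rewrite normrM (gtr0_norm (_ : 0 < sin t)); last by lra.
have := sin2cos2 w; rewrite -(real_normK (num_real (sin w))) -(real_normK (num_real (cos w))).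
have := normr_ge0 (sin w); have := normr_ge0 (cos w).
move: cw kt {cwt key}; move: (sin t) `|sin w| `|cos w| => T S C cw kT C0 S0 SC TS.
have S2 : S <= 2^-1 by rewrite leNgt; apply/negP => S2; nra.
nra.
Qed.

Lemma bulk_itv a z : - 2^-1 < a -> a < 0 -> -1 - a <= z -> z <= a -> -1 < z /\ z < 0.
Proof. by move=> *; split; lra. Qed.

Lemma cos_angle_ge a z : - 2^-1 < a -> a < 0 -> -1 - a <= z -> z <= a ->
  cos (angle a) <= cos (angle z).
Proof.
move=> a1 a0 az za; have [z1 z0] := bulk_itv a1 a0 az za.
have h1 : angle z <= angle a by exact: le_angle.
have h2 : - angle a <= angle z by rewrite -angle_symm; apply: le_angle => //; lra.
have : `|angle z| <= angle a by rewrite ler_norml h1 h2.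
rewrite -(cos_norm (angle z)) le_eqVlt => /predU1P[-> //|h].
have := angle_ltpi2 a; have := normr_ge0 (angle z) => nz ap.
by apply/ltW; rewrite ltr_cos ?in_itv /=; lra.
Qed.

(** The excess e over pi leaves room to move the first point until its cosine is not small. The
    point whose phase is smaller by pi then has the opposite cosine, so P_n changes sign in
    between. *)
Lemma root_between a e : - 2^-1 < a -> a < 0 -> 0 < e ->
  \forall n \near \oo, forall x y, -1 - a <= x -> x < y -> y <= a ->
  pi + e <= n.+1%:R * (angle y - angle x) ->
  exists2 r, x < r < y & root (P n) r.
Proof.
move=> a1 a0 e0; have p0 := pi_gt0 R; have p2 := pi_ge2 R.
pose d := Num.min e 1; have d0 : 0 < d by rewrite lt_min e0 ltr01.
have de : d <= e by rewrite ge_min lexx.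
have d1 : d <= 1 by rewrite ge_min lexx orbT.
have s0 : 0 < sin (d / 3) by apply: sin_gt0_pi; rewrite divr_gt0 //=; lra.
(* As 2 h < sin (d / 3), two phases at distance d / 3 cannot both have a cosine of size at most h;
   these are [c1] and [c2] below. *)
pose h := sin (d / 3) / 3; have h0 : 0 < h by rewrite divr_gt0.
have [N _ hN] := cos_approx a1 a0 h0.
exists N => // n /= /hN {}hN x y ax xy ya hxy.
have n0 : 0 < n.+1%:R :> R by rewrite ltr0n.
have nn : n.+1%:R != 0 :> R by rewrite gt_eqF.
have x1 : -1 < x by lra.
have y0 : y < 0 by lra.
pose psi z := n.+1%:R * (pi / 2 - angle z).
have at_chi t : 0 < t -> t < pi + d -> exists2 c, x < c < y & psi c = psi x - t.
  move=> t0 td.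
  have [||c xcy cE] := @angle_IVT R x y (angle x + t / n.+1%:R) x1 xy y0.
  - by rewrite ltrDl divr_gt0.
  - by rewrite -ltrBrDl ltr_pdivrMr // mulrC; lra.
  by exists c => //; rewrite /psi cE; field.
have [p [q [xp pq [qy [hp hq]]]]] : exists p q, [/\ x < p, p < q & q < y /\
    h < `|cos (psi p)| /\ cos (psi q) = - cos (psi p)].
  have choose t : 0 < t -> t < d -> (exists2 c, x < c < y & psi c = psi x - t /\ h < `|cos (psi c)|) ->
    exists p q, [/\ x < p, p < q & q < y /\
    h < `|cos (psi p)| /\ cos (psi q) = - cos (psi p)].
    move=> t0 td [p /andP[xp py] [pE hp]].
    have [||q /andP[xq qy] qE] := at_chi (t + pi); [lra|lra|].
    exists p, q; split=> //.
      rewrite ltNge; apply/negP => qp.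
      have := le_angle (lt_trans x1 xq) qp (lt_trans py y0).
      have : psi q < psi p by rewrite pE qE; lra.
      by rewrite /psi ltr_pM2l // => ? ?; lra.
    split=> //; split=> //.
    have -> : psi p = psi q + pi by rewrite pE qE; ring.
    by rewrite cosDpi opprK.
  have [||c1 c1i c1E] := at_chi (d / 3); [lra|lra|].
  have [||c2 c2i c2E] := at_chi (d / 3 + d / 3); [lra|lra|].
  have [hc1|hc1] := ltP h `|cos (psi c1)|.
    by apply: (choose (d / 3)); [lra|lra|exists c1].
  have [hc2|hc2] := ltP h `|cos (psi c2)|.
    by apply: (choose (d / 3 + d / 3)); [lra|lra|exists c2].
  have := normr_sinB_le hc1 hc2.
  have -> : psi c1 - psi c2 = d / 3 by rewrite c1E c2E; ring.
  by rewrite (ger0_norm (ltW s0)) /h; lra.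
have ap := le_trans ax (ltW xp); have qa := le_trans (ltW qy) ya.
have [cp cp0 happ] := hN p ap (le_trans (ltW pq) qa).
have [cq cq0 haqq] := hN q (le_trans ap (ltW pq)) qa.
have Ppq : (P n).[p] * (P n).[q] < 0.
  apply: (mulr_lt0_of_approx cp0 cq0 happ _ hp).
  by rewrite -[cos _]opprK -hq.
have [r] := poly_ivtoo (ltW pq) Ppq.
rewrite in_itv /= => /andP[pr rq] Pr; exists r => //.
by rewrite (lt_trans xp pr) (lt_trans rq qy).
Qed.

(* Two closer zeros would enclose, by Rolle, a zero of P_(n+1), where the cosines
   for n and n + 1 would both be small although their arguments differ by an
   angle bounded away from 0 and pi. *)
Lemma root_spacing a e : - 2^-1 < a -> a < 0 -> 0 < e ->
  \forall n \near \oo, forall x y, -1 - a <= x -> x < y -> y <= a ->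
  root (P n) x -> root (P n) y ->
  pi - e <= n.+1%:R * (angle y - angle x).
Proof.
move=> a1 a0 e0; have p0 := pi_gt0 R; have p2 := pi_ge2 R.
pose k := cos (angle a).
have k0 : 0 < k by rewrite /k cos_gt0_pihalf // angle_ltpi2 angle_gtNpi2.
have k1 : k <= 1 by exact: cos_le1.
(* sin d < k / 6 is what [cos_rotation_neq] requires, and d < e and d < 1 are for
   [lt_of_normr_sin_lt]. *)
have [d [d0 [d1 [de dk]]]] : exists d : R, 0 < d /\ d < 1 /\ d < e /\ sin d < k / 6.
  have hs : (sin : R -> R) @ 0^'+ --> sin 0.
    by apply: cvg_at_right_filter; exact: continuous_sin.
  have k6 : sin 0 < k / 6 by rewrite sin0 divr_gt0.
  have hk := cvgr_lt _ hs _ k6.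
  near (0 : R)^'+ => d; exists d; split; first by near: d; exact: nbhs_right_gt.
  split; first by near: d; exact: nbhs_right_lt.
  split; first by near: d; exact: nbhs_right_lt.
  by near: d; exact: hk.
have s0 : 0 < sin d by apply: sin_gt0_pi; rewrite d0 /=; lra.
set s := sin d in s0 dk.
pose h := s / 3; have h0 : 0 < h by rewrite divr_gt0.
have [N _ hN] := cos_approx a1 a0 h0.
exists N => // n /= Nn x y ax xy ya Px Py.
have n0 : 0 < n.+1%:R :> R by rewrite ltr0n.
have small m z : (N <= m)%N -> -1 - a <= z -> z <= a -> root (P m) z ->
    `|cos (m.+1%:R * (pi / 2 - angle z))| <= h.
  move=> Nm az za /rootP Pz; have [c _] := hN m Nm z az za.
  by rewrite Pz mulr0 sub0r normrN.
have [x1 x0] := bulk_itv a1 a0 ax (le_trans (ltW xy) ya).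
have [y1 y0] := bulk_itv a1 a0 (le_trans ax (ltW xy)) ya.
have sx := small n x Nn ax (le_trans (ltW xy) ya) Px.
have sy := small n y Nn (le_trans ax (ltW xy)) ya Py.
rewrite leNgt; apply/negP => hlt.
set u := n.+1%:R * (pi / 2 - angle x) in sx.
set v := n.+1%:R * (pi / 2 - angle y) in sy.
have uv : u - v = n.+1%:R * (angle y - angle x) by rewrite /u /v; ring.
have uv0 : 0 < u - v by rewrite uv mulr_gt0 // subr_gt0 lt_angle.
(* Both cosines are at most sin d / 3, so the sine of the difference is below sin d; as the
   difference is less than pi - e, it must be tiny. *)
have uvd : u - v < d.
  apply: (lt_of_normr_sin_lt d0 (ltW de) (ltW d1) (ltW uv0)).
    by rewrite uv ltW.
  apply: le_lt_trans (normr_sinB_le sx sy) _.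
  by rewrite /h mulrA ltr_pdivrMr // mulrC ltr_pM2l // ltr_nat.
have [|r] := @poly_rolle R x y ((1 + 'X) * P n) xy.
  by rewrite !hornerM (rootP Px) (rootP Py) !mulr0.
rewrite in_itv /= => /andP[xr ry] Qr.
have Pr : root (P n.+1) r.
  by apply/rootP; rewrite geometric_poly_deriv_rec // hornerM Qr mulr0.
have ar := le_trans ax (ltW xr); have ra := le_trans (ltW ry) ya.
have sr := small n.+1 r (leq_trans Nn (leqnSn n)) ar ra Pr.
set w := n.+1%:R * (pi / 2 - angle r).
have wE : n.+2%:R * (pi / 2 - angle r) = w + (pi / 2 - angle r).
  by rewrite /w -[n.+2%:R]natr1; ring.
have uwE : u - w = n.+1%:R * (angle r - angle x) by rewrite /u /w; ring.
have wvE : w - v = n.+1%:R * (angle y - angle r) by rewrite /v /w; ring.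
have uw : 0 <= u - w.
  by rewrite uwE mulr_ge0 // subr_ge0; apply: le_angle (ltW xr) (lt_trans ry y0).
have wv : 0 <= w - v.
  by rewrite wvE mulr_ge0 // subr_ge0; apply: le_angle (lt_trans x1 xr) (ltW ry) y0.
have hs : h <= s by rewrite ler_pdivrMr // ler_peMr ?(ltW s0) // ler1n.
have cw : `|cos w| <= 2 * s.
  have uwd : u - w < d by apply: le_lt_trans uvd; rewrite lerD2l lerN2 -subr_ge0.
  rewrite -[w](subKr u); apply: le_trans (normr_cosB_le u uw uwd (ltW d1)) _.
  by rewrite mulr_natl mulr2n lerD2r (le_trans sx hs).
(* Passing from n to n + 1 rotates the phase of r by pi / 2 - angle r, whose sine cos (angle r) is
   at least [k] on the bulk. *)
apply: (@cos_rotation_neq k s (pi / 2 - angle r) w) => //.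
- by rewrite mulrC -ltr_pdivlMr.
- by rewrite sinB sin_pihalf cos_pihalf mul1r mul0r subr0 cos_angle_ge.
- by rewrite -wE (le_trans sr hs).
Unshelve. all: by end_near. Qed.

End Roots.

(** * Angular distance of consecutive zeros and their numbering *)

Section Zeros.
Variables (R : realType) (P : nat -> {poly R}).
Hypothesis P_geom : geometric_polys P.
Implicit Types (x y z a e : R).

Lemma consecutive_angle a e : - 2^-1 < a -> a < 0 -> 0 < e ->
  \forall n \near \oo, forall x y, consecutive_zeros (P n) x y ->
  -1 - a <= x -> y <= a ->
  pi - e <= n.+1%:R * (angle y - angle x) /\ n.+1%:R * (angle y - angle x) <= pi + e.
Proof.
move=> a1 a0 e0.
near=> n; move=> x y [xy Px Py noroot] ax ya; split.
  by move: x y ax xy ya Px Py {noroot}; near: n; exact: root_spacing.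
rewrite leNgt; apply/negP => /ltW h.
have [r rxy Pr] : exists2 r, x < r < y & root (P n) r.
  by move: x y ax xy ya h {Px Py noroot}; near: n; exact: root_between.
by have := noroot r rxy; rewrite Pr.
Unshelve. all: by end_near. Qed.

(** Angles are converted to distances by the bounds on [dangle]. For the lower bound, - z (1 + z) is
    smallest at the ends of the bulk interval, which gives the constant - a (1 + a). *)
Lemma consecutive_dist a e : - 2^-1 < a -> a < 0 -> 0 < e ->
  \forall n \near \oo, forall x y, consecutive_zeros (P n) x y ->
  -1 - a <= x -> y <= a ->
  pi * (- a * (1 + a)) * (pi - e) / n.+1%:R <= y - x /\
  y - x <= pi / 4 * (pi + e) / n.+1%:R.
Proof.
move=> a1 a0 e0; have p0 := pi_gt0 R.
apply: filterS (consecutive_angle a1 a0 e0) => n h x y xyc ax ya.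
have [h1 h2] := h x y xyc ax ya; case: xyc => xy _ _ _.
have n0 : 0 < n.+1%:R :> R by rewrite ltr0n.
have x1 : -1 < x by lra.
have y0 : y < 0 by lra.
have m0 : 0 < - a * (1 + a) by apply: mulr_gt0; lra.
split.
  have mx : - a * (1 + a) <= - x * (1 + x) by nra.
  have my : - a * (1 + a) <= - y * (1 + y) by nra.
  apply: le_trans (angle_sub_le x1 (ltW xy) y0 m0 mx my).
  by rewrite -(mulrA (pi * _)) ler_wpM2l ?(mulr_ge0 (ltW p0) (ltW m0)) // ler_pdivrMr // mulrC.
apply: le_trans (angle_sub_ge x1 (ltW xy) y0) _.
by rewrite -(mulrA (pi / 4)) ler_wpM2l ?divr_ge0 ?(ltW p0) // ler_pdivlMr // mulrC.
Qed.

(** [root_between] is applied up to the point whose scaled angular distance from x is exactly pi +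
    e, so the zero found is also localized. *)
Lemma exists_next_root a e : - 2^-1 < a -> a < 0 -> 0 < e ->
  \forall n \near \oo, forall x, -1 - a <= x -> x < a ->
  pi + e < n.+1%:R * (angle a - angle x) ->
  exists r, [/\ x < r, r < a, root (P n) r & n.+1%:R * (angle r - angle x) <= pi + e].
Proof.
move=> a1 a0 e0; have p0 := pi_gt0 R.
apply: filterS (root_between P_geom a1 a0 e0) => n h x ax xa hx.
have n0 : 0 < n.+1%:R :> R by rewrite ltr0n.
have x1 : -1 < x by lra.
have [||y /andP[xy ya] yE] := @angle_IVT R x a (angle x + (pi + e) / n.+1%:R) x1 xa a0.
- by rewrite ltrDl divr_gt0 // addr_gt0.
- by rewrite -ltrBrDl ltr_pdivrMr // mulrC.
have yxE : n.+1%:R * (angle y - angle x) = pi + e.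
  by rewrite yE addrAC subrr add0r mulrCA divff ?mulr1 // gt_eqF.
have [||r /andP[xr ry] Pr] := h x y ax xy _ _; rewrite ?yxE //; first exact: ltW.
exists r; split=> //; first exact: lt_trans ya.
rewrite -yxE ler_pM2l // lerD2r ltW // lt_angle //; lra.
Qed.

Lemma mem_right_zeros n x :
  (x \in right_zeros (P n)) = [&& root (P n) x, x != 0 & - 2^-1 < x].
Proof.
rewrite mem_filter andbC; congr (_ && _).
have := roots_on_rootsR (geometric_poly_neq0 P_geom n) x.
by rewrite in_itv.
Qed.

Lemma mem_left_zeros n x :
  (x \in left_zeros (P n)) = [&& root (P n) x, x != 0 & x < - 2^-1].
Proof.
rewrite mem_filter andbC; congr (_ && _).
have := roots_on_rootsR (geometric_poly_neq0 P_geom n) x.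
by rewrite in_itv.
Qed.

Lemma sorted_right_zeros n : sorted <%R (right_zeros (P n)).
Proof. by apply: sorted_filter; [exact: lt_trans | exact: sorted_roots]. Qed.

Lemma sorted_left_zeros n : sorted <%R (left_zeros (P n)).
Proof. by apply: sorted_filter; [exact: lt_trans | exact: sorted_roots]. Qed.

Lemma left_zeros_symm n :
  rev (left_zeros (P n)) = [seq -1 - x | x <- right_zeros (P n)].
Proof.
apply: (canLR revK); apply: lt_sorted_eq; first exact: sorted_left_zeros.
  rewrite rev_sorted sorted_map.
  apply: sub_sorted (sorted_right_zeros n) => x y /=; lra.
move=> x; rewrite mem_rev mem_left_zeros.
have symm y : y != 0 -> y != -1 -> root (P n) (-1 - y) = root (P n) y.
  exact: geometric_poly_root_symm.
apply/and3P/mapP => [[Px x0 xh]|[y]].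
  have x1 : x != -1 by apply: contraTneq Px => ->; exact: geometric_poly_rootN1.
  exists (-1 - x); last by ring.
  rewrite mem_right_zeros symm // Px /=; apply/andP; split; last by lra.
  by apply: contra x1 => /eqP h; apply/eqP; lra.
rewrite mem_right_zeros => /and3P[Py y0 yh] ->.
have y1 : y != -1 by apply: contraTneq Py => ->; exact: geometric_poly_rootN1.
rewrite symm // Py; split=> //; last by lra.
by apply: contra y1 => /eqP h; apply/eqP; lra.
Qed.

Lemma zero_idx_symm n (j : int) : zero_idx (P n) (- j) + zero_idx (P n) j = -1.
Proof.
have pos k : zero_idx (P n) (Negz k) + zero_idx (P n) (Posz k.+1) = -1.
  rewrite /= left_zeros_symm.
  have [kr|kr] := ltnP k (size (right_zeros (P n))).
    by rewrite (nth_map (- 2^-1)) // subrK.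
  (* Beyond the last zero both sides take the default -1/2, and the sum is still -1. *)
  by rewrite !nth_default ?size_map //; lra.
case: j => [[|k]|k]; first by rewrite oppr0 /=; lra.
  by rewrite -NegzE pos.
by rewrite NegzE opprK addrC -NegzE pos.
Qed.

(** The zero r guarantees that the list continues after i. A zero strictly between two neighbouring
    entries would have its index strictly between i and i + 1. *)
Lemma right_zeros_next n i r : (i < size (right_zeros (P n)))%N ->
  r \in right_zeros (P n) -> nth (- 2^-1) (right_zeros (P n)) i < r ->
  [/\ (i.+1 < size (right_zeros (P n)))%N,
      nth (- 2^-1) (right_zeros (P n)) i.+1 <= r &
      consecutive_zeros (P n) (nth (- 2^-1) (right_zeros (P n)) i)
        (nth (- 2^-1) (right_zeros (P n)) i.+1)].
Proof.
set s := right_zeros (P n) => is_ rs ir.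
have mono := lt_sorted_ltn_nth (- 2^-1) (sorted_right_zeros n).
have lem := lt_sorted_leq_nth (- 2^-1) (sorted_right_zeros n).
have idx u : u \in s -> nth (- 2^-1) s i < u -> (i < index u s)%N.
  move=> us iu; rewrite -(mono i (index u s)) ?inE ?index_mem //.
  by rewrite nth_index.
have rl := idx r rs ir.
have si : (i.+1 < size s)%N by apply: leq_ltn_trans rl _; rewrite index_mem.
have mem k : (k < size s)%N -> [/\ root (P n) (nth (- 2^-1) s k),
    nth (- 2^-1) s k < 0 & - 2^-1 < nth (- 2^-1) s k].
  move=> /(mem_nth (- 2^-1)); rewrite mem_right_zeros => /and3P[Pk k0 kh]; split=> //.
  by have /andP[] := geometric_poly_root_itv P_geom Pk k0.
split=> //.
  by rewrite -[leRHS](nth_index (- 2^-1) rs) lem ?inE ?index_mem.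
have [Pi i0 ih] := mem i is_; have [Pi1 i10 i1h] := mem i.+1 si.
split=> //; first by rewrite mono ?inE.
move=> u /andP[iu ui]; apply/negP => Pu.
have us : u \in s.
  by rewrite mem_right_zeros Pu lt_eqF ?(lt_trans ui) //= (lt_trans ih).
have := idx u us iu; rewrite ltnNge => /negP; apply.
by rewrite -ltnS -(mono _ i.+1) ?inE ?index_mem // nth_index.
Qed.

Lemma right_zeros_first n r : r \in right_zeros (P n) ->
  (0 < size (right_zeros (P n)))%N /\ nth (- 2^-1) (right_zeros (P n)) 0 <= r.
Proof.
move=> rs; have s0 : (0 < size (right_zeros (P n)))%N.
  by apply: leq_ltn_trans (leq0n (index r (right_zeros (P n)))) _; rewrite index_mem.
split=> //; rewrite -[leRHS](nth_index (- 2^-1) rs).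
by rewrite (lt_sorted_leq_nth _ (sorted_right_zeros n)) ?inE ?index_mem.
Qed.

End Zeros.

(** * The zeros nearest to -1/2 *)

Section Asymptotics.
Variables (R : realType) (P : nat -> {poly R}).
Hypothesis P_geom : geometric_polys P.
Implicit Types (x y z a e : R).

Lemma near_infty_mulr_gt (C t : R) : 0 < t -> \forall n \near \oo, C < n.+1%:R * t.
Proof.
move=> t0; apply: filterS (nbhs_infty_gtr (C / t)) => n.
rewrite ltr_pdivrMr // => /lt_le_trans; apply.
by rewrite ler_wpM2r ?ltW // ltr_nat.
Qed.

Lemma angle_quarter_gt0 : 0 < angle (- 4^-1 : R).
Proof. by rewrite -(angle_half R) lt_angle //; lra. Qed.

(** At z = -1/2 the phase is (n + 1) pi / 2, a multiple of pi for odd n, so the approximating cosine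
    is 1 or -1. *)
Lemma geometric_poly_half_neq0 :
  \forall n \near \oo, odd n -> ~~ root (P n) (- 2^-1).
Proof.
have h1 : - 2^-1 < - 4^-1 :> R by lra.
have h2 : - 4^-1 < 0 :> R by lra.
have h3 : 0 < 2^-1 :> R by lra.
apply: filterS (cos_approx P_geom h1 h2 h3) => n h on; apply/negP => /rootP P0.
have [c c0] := h (- 2^-1) ltac:(lra) ltac:(lra).
rewrite P0 mulr0 sub0r normrN angle_half subr0.
have -> : n.+1%:R * (pi / 2) = 0 + pi *+ n.+1./2 :> R.
  have nE : n.+1 = (n.+1./2 * 2)%N by rewrite muln2 -[LHS]odd_double_half /= on.
  by rewrite add0r [in LHS]nE natrM -mulr_natl; field.
rewrite (alternatingn (@cosDpi R)) cos0 mulr1 normrX normrN normr1 expr1n.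
lra.
Qed.

(* For even n the first zero is compared with the zero -1/2, for odd n with its
   mirror image. *)
Lemma right_zero0_angle e : 0 < e ->
  \forall n \near \oo,
    [/\ (0 < size (right_zeros (P n)))%N, nth (- 2^-1) (right_zeros (P n)) 0 <= - 4^-1 &
     `|n.+1%:R * angle (nth (- 2^-1) (right_zeros (P n)) 0) -
        (1 - (odd n)%:R / 2) * pi| <= e].
Proof.
move=> e0; have p0 := pi_gt0 R.
have h1 : - 2^-1 < - 4^-1 :> R by lra.
have h2 : - 4^-1 < 0 :> R by lra.
near=> n; set s := right_zeros (P n).
have n0 : 0 < n.+1%:R :> R by rewrite ltr0n.
(* The bound -1/4 is just a fixed bulk endpoint. For large n there is room for the wanted zero
   before it. *)
have big : pi + e < n.+1%:R * angle (- 4^-1 : R).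
  by near: n; exact: near_infty_mulr_gt angle_quarter_gt0.
have spac x y : -1 - (- 4^-1) <= x -> x < y -> y <= - 4^-1 ->
    root (P n) x -> root (P n) y -> pi - e <= n.+1%:R * (angle y - angle x).
  by move: x y; near: n; exact: root_spacing.
have spos x : x \in s -> - 2^-1 < x by rewrite mem_right_zeros // => /and3P[].
have sroot x : x \in s -> root (P n) x by rewrite mem_right_zeros // => /and3P[].
case on : (odd n); rewrite /=.
  (* With this angle of y, the interval (-1 - y, y) has scaled angular length pi + e and so contains
     a zero. It is not -1/2, and reflecting it if necessary puts it on the right. *)
  have [||y /andP[hy ya] yE] := @angle_IVT R (- 2^-1) (- 4^-1) ((pi + e) / 2 / n.+1%:R) ltac:(lra) h1 h2.
  - by rewrite angle_half !divr_gt0 // addr_gt0.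
  - by rewrite ltr_pdivrMr // mulrC; lra.
  have [r /andP[yr ry] Pr] : exists2 r, -1 - y < r < y & root (P n) r.
    have aux x z : -1 - (- 4^-1) <= x -> x < z -> z <= - 4^-1 ->
      pi + e <= n.+1%:R * (angle z - angle x) -> exists2 r, x < r < z & root (P n) r.
      by move: x z; near: n; exact: root_between.
    apply: aux; [lra|lra|exact: ltW|].
    by rewrite angle_symm opprK yE -mulrDl -splitr mulrCA divff ?mulr1 // gt_eqF.
  have rh : r != - 2^-1.
    by apply: contraTneq Pr => ->; move: on; near: n; exact: geometric_poly_half_neq0.
  have [r' [r's r'y]] : exists r', r' \in s /\ r' < y.
    have neq0 x : x < 0 -> x != 0 by move=> h; rewrite lt_eqF.
    have neqN1 x : -1 < x -> x != -1 by move=> h; rewrite gt_eqF.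
    have [rl|rg] := ltP r (- 2^-1).
      exists (-1 - r); rewrite mem_right_zeros // geometric_poly_root_symm //.
      - by rewrite Pr neq0 /=; [split; lra|lra].
      - by rewrite neq0 //; lra.
      - by rewrite neqN1 //; lra.
    exists r; rewrite mem_right_zeros // Pr neq0 /=; last by lra.
    by rewrite lt_neqAle eq_sym rh.
  have [s0 zr] := right_zeros_first r's; rewrite -/s in s0 zr *.
  set z := nth _ s 0 in zr *; have zs : z \in s by exact: mem_nth.
  have zh := spos z zs; have Pz := sroot z zs.
  have z4 : z <= - 4^-1 by lra.
  have zn : z != 0 by rewrite lt_eqF //; lra.
  have zn1 : z != -1 by rewrite gt_eqF //; lra.
  have Pz' : root (P n) (-1 - z) by rewrite geometric_poly_root_symm.
  have lo := spac (-1 - z) z ltac:(lra) ltac:(lra) z4 Pz' Pz.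
  rewrite angle_symm in lo.
  have up : n.+1%:R * angle z <= (pi + e) / 2.
    have : angle z <= angle y by apply: le_angle; lra.
    by rewrite yE ler_pdivlMr // mulrC.
  by split=> //; rewrite ler_norml; lra.
have Ph : root (P n) (- 2^-1).
  apply: geometric_poly_root_half => //; last by rewrite on.
  by near: n; exact: nbhs_infty_gt.
have [r [hr ra Pr up]] : exists r, [/\ - 2^-1 < r, r < - 4^-1, root (P n) r &
    n.+1%:R * (angle r - angle (- 2^-1)) <= pi + e].
  have aux x : -1 - (- 4^-1) <= x -> x < - 4^-1 ->
    pi + e < n.+1%:R * (angle (- 4^-1) - angle x) ->
    exists r, [/\ x < r, r < - 4^-1, root (P n) r & n.+1%:R * (angle r - angle x) <= pi + e].
    by move: x; near: n; exact: exists_next_root.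
  by apply: aux; rewrite ?angle_half ?subr0 //; lra.
have rs : r \in s by rewrite mem_right_zeros // Pr hr lt_eqF //; lra.
have [s0 zr] := right_zeros_first rs; rewrite -/s in s0 zr *.
set z := nth _ s 0 in zr *; have zs : z \in s by exact: mem_nth.
have zh := spos z zs; have Pz := sroot z zs.
have z4 : z <= - 4^-1 by lra.
have lo := spac (- 2^-1) z ltac:(lra) zh z4 Ph Pz.
rewrite angle_half subr0 in lo up.
have up' : n.+1%:R * angle z <= n.+1%:R * angle r.
  by rewrite ler_pM2l //; apply: le_angle; lra.
by split=> //; rewrite ler_norml; lra.
Unshelve. all: by end_near. Qed.

(** List position j holds the zero of index j + 1. Each induction step adds one spacing pi and
    spends half of e on it; the bound -1/4 is carried along to stay inside a fixed bulk interval. *)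
Lemma right_zero_angle j e : 0 < e ->
  \forall n \near \oo,
    [/\ (j < size (right_zeros (P n)))%N, nth (- 2^-1) (right_zeros (P n)) j <= - 4^-1 &
     `|n.+1%:R * angle (nth (- 2^-1) (right_zeros (P n)) j) -
        (j.+1%:R - (odd n)%:R / 2) * pi| <= e].
Proof.
elim: j e => [|j IH] e e0; first exact: right_zero0_angle.
have p0 := pi_gt0 R.
have h1 : - 2^-1 < - 4^-1 :> R by lra.
have h2 : - 4^-1 < 0 :> R by lra.
have e20 : 0 < e / 2 by rewrite divr_gt0.
near=> n.
have n0 : 0 < n.+1%:R :> R by rewrite ltr0n.
have big : j.+1%:R * pi + pi + e + e < n.+1%:R * angle (- 4^-1 : R).
  by near: n; exact: near_infty_mulr_gt angle_quarter_gt0.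
have [js ja jE] : [/\ (j < size (right_zeros (P n)))%N,
    nth (- 2^-1) (right_zeros (P n)) j <= - 4^-1 &
    `|n.+1%:R * angle (nth (- 2^-1) (right_zeros (P n)) j) -
       (j.+1%:R - (odd n)%:R / 2) * pi| <= e / 2].
  by near: n; exact: IH.
set s := right_zeros (P n) in js ja jE *.
set z := nth _ s j in ja jE *.
have : z \in s by exact: mem_nth.
rewrite mem_right_zeros // => /and3P[Pz z0 zh].
have o0 : 0 <= (odd n)%:R / 2 * pi :> R by rewrite mulr_ge0 ?divr_ge0 // ltW.
have za : z < - 4^-1.
  rewrite lt_neqAle ja andbT; apply/eqP => zE.
  by move: jE; rewrite zE ler_norml mulrBl => /andP[_]; lra.
have [r [zr ra Pr up]] : exists r, [/\ z < r, r < - 4^-1, root (P n) r &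
    n.+1%:R * (angle r - angle z) <= pi + e / 2].
  have aux x : -1 - (- 4^-1) <= x -> x < - 4^-1 ->
    pi + e / 2 < n.+1%:R * (angle (- 4^-1) - angle x) ->
    exists r, [/\ x < r, r < - 4^-1, root (P n) r & n.+1%:R * (angle r - angle x) <= pi + e / 2].
    by move: x; near: n; exact: exists_next_root.
  apply: aux => //; first by lra.
  by move: jE; rewrite ler_norml !mulrBl => /andP[_]; lra.
have rs : r \in s by rewrite mem_right_zeros // Pr (lt_trans zh zr) lt_eqF //; lra.
have [js1 z1r [zz1 _ Pz1 _]] := right_zeros_next P_geom js rs zr.
rewrite -/s -/z in js1 z1r zz1 Pz1 *; set z1 := nth _ s j.+1 in z1r zz1 Pz1 *.
have z1a : z1 <= - 4^-1 by lra.
have lo : pi - e / 2 <= n.+1%:R * (angle z1 - angle z).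
  have spac x y : -1 - (- 4^-1) <= x -> x < y -> y <= - 4^-1 ->
    root (P n) x -> root (P n) y -> pi - e / 2 <= n.+1%:R * (angle y - angle x).
    by move: x y; near: n; exact: root_spacing.
  by apply: spac => //; lra.
have up' : n.+1%:R * angle z1 <= n.+1%:R * angle r.
  by rewrite ler_pM2l //; apply: le_angle; lra.
split=> //; move: jE; rewrite !ler_norml -[j.+2%:R]natr1; lra.
Unshelve. all: by end_near. Qed.


End Asymptotics.

(** * From angles back to zeros *)

Section ZeroAsymptotics.
Variables (R : realType) (P : nat -> {poly R}).
Hypothesis P_geom : geometric_polys P.

(** With w = z + 1/2 and t = angle z, the two bounds on the slope give pi (1/4 - w^2) t <= w <= (pi
    / 4) t. Since w <= t, the gap is at most pi t^3. *)
Lemma angle_half_approx (z : R) : - 2^-1 < z -> z <= - 4^-1 ->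
  `|z + 2^-1 - pi / 4 * angle z| <= 4 * angle z ^+ 3.
Proof.
move=> z2 z4; have p0 := pi_gt0 R.
have p4 : pi <= 4 :> R by have := pihalf_lt2 R; lra.
have up := @angle_sub_ge R (- 2^-1) z ltac:(lra) (ltW z2) ltac:(lra).
have m0 : 0 < - z * (1 + z) by apply: mulr_gt0; lra.
have mh : - z * (1 + z) <= - - 2^-1 * (1 + - 2^-1) by have := sqr_ge0 (z + 2^-1); lra.
have lo := @angle_sub_le R (- 2^-1) z _ ltac:(lra) (ltW z2) ltac:(lra) m0 mh (lexx _).
rewrite angle_half subr0 opprK in up lo.
have t0 : 0 <= angle z by rewrite -(angle_half R); apply: le_angle; lra.
set t := angle z in up lo t0 *; set w := z + 2^-1 in up lo *.
have mE : - z * (1 + z) = 4^-1 - w ^+ 2 by rewrite /w; field.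
rewrite mE in lo.
have w0 : 0 <= w by rewrite /w; lra.
have wt : w <= t by apply: le_trans up _; rewrite -[leRHS]mul1r ler_wpM2r //; lra.
have w2 : w ^+ 2 <= t ^+ 2 by rewrite ler_sqr ?nnegrE.
have h : pi * w ^+ 2 * t <= 4 * t ^+ 3.
  rewrite (exprSr t 2) mulrA ler_wpM2r //; apply: ler_pM => //; [exact: ltW|exact: sqr_ge0].
by rewrite ler_norml; apply/andP; split; lra.
Qed.

(** The factor pi^2 / 4 is the slope pi / 4 times the angular spacing pi. As the angle is O(1/n),
    the cubic error of the linearization is negligible against 1/n. *)
Lemma right_zero_asymp (j : nat) (e : R) : 0 < e ->
  \forall n \near \oo,
    `|nth (- 2^-1) (right_zeros (P n)) j -
       (- 2^-1 + pi ^+ 2 / 4 * ((j.+1%:R - (odd n)%:R / 2) / n.+1%:R))| <= e / n.+1%:R.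
Proof.
move=> e0; have p0 := pi_gt0 R.
have p4 : pi <= 4 :> R by have := pihalf_lt2 R; lra.
(* A bound for (n + 1) angle z that does not depend on n. *)
pose C : R := j.+1%:R * pi + e / 2.
have C0 : 0 < C by rewrite addr_gt0 ?mulr_gt0 ?divr_gt0 ?ltr0n.
have e20 : 0 < e / 2 by rewrite divr_gt0.
near=> n.
have n0 : 0 < n.+1%:R :> R by rewrite ltr0n.
have n1 : 1 <= n.+1%:R :> R by rewrite ler1n.
have [js ja jE] : [/\ (j < size (right_zeros (P n)))%N,
    nth (- 2^-1) (right_zeros (P n)) j <= - 4^-1 &
    `|n.+1%:R * angle (nth (- 2^-1) (right_zeros (P n)) j) -
       (j.+1%:R - (odd n)%:R / 2) * pi| <= e / 2].
  by near: n; exact: right_zero_angle.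
have big : 4 * C ^+ 3 < n.+1%:R * (e / 2) by near: n; exact: near_infty_mulr_gt.
have : nth (- 2^-1) (right_zeros (P n)) j \in right_zeros (P n) by exact: mem_nth.
move: ja jE; set z := nth _ _ _ => ja jE.
rewrite mem_right_zeros // => /and3P[_ _ zh].
have hz := angle_half_approx zh ja.
have t0 : 0 <= angle z by rewrite -(angle_half R); apply: le_angle; lra.
set t := angle z in hz jE t0; set c := j.+1%:R - (odd n)%:R / 2 in jE *.
have tC : n.+1%:R * t <= C.
  have o0 : 0 <= (odd n)%:R / 2 * pi :> R by rewrite mulr_ge0 ?divr_ge0 // ltW.
  by move: jE; rewrite /c ler_norml mulrBl => /andP[_]; rewrite /C; lra.
have t3 : n.+1%:R * (4 * t ^+ 3) <= e / 2.
  rewrite -(ler_pM2l n0); apply: le_trans (ltW big).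
  have -> : n.+1%:R * (n.+1%:R * (4 * t ^+ 3)) = 4 * (n.+1%:R ^+ 2 * t ^+ 3) by ring.
  rewrite ler_wpM2l //; apply: (@le_trans _ _ ((n.+1%:R * t) ^+ 3)).
    rewrite exprMn ler_wpM2r ?exprn_ge0 // [leRHS]exprS ler_peMl ?sqr_ge0 //.
  by apply: lerXn2r; rewrite ?nnegrE ?mulr_ge0 // ltW.
have -> : z - (- 2^-1 + pi ^+ 2 / 4 * (c / n.+1%:R)) =
   ((z + 2^-1 - pi / 4 * t) * n.+1%:R + pi / 4 * (n.+1%:R * t - c * pi)) / n.+1%:R.
  by field; rewrite gt_eqF.
rewrite normrM normfV (gtr0_norm n0) ler_wpM2r ?invr_ge0 ?(ltW n0) //.
apply: le_trans (ler_normD _ _) _; rewrite !normrM (gtr0_norm n0) (gtr0_norm p0).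
rewrite (gtr0_norm (_ : 0 < 4^-1)) //.
have h1 : `|z + 2^-1 - pi / 4 * t| * n.+1%:R <= e / 2.
  by apply: le_trans t3; rewrite mulrC ler_wpM2l // ltW.
have h2 : pi / 4 * `|n.+1%:R * t - c * pi| <= e / 2.
  apply: le_trans jE; rewrite -[leRHS]mul1r ler_wpM2r //; lra.
lra.
Unshelve. all: by end_near. Qed.

(** This passes from 1 / (n + 1) to 1 / n. The factor - 4 a (1 + a) is the ratio of the two slope
    bounds and tends to 1 as a tends to -1/2. *)
Lemma consecutive_bulk (a e : R) : - 2^-1 < a -> a < 0 -> 0 < e ->
  \forall n \near \oo, forall x y, consecutive_zeros (P n) x y -> -1 - a < x -> y < a ->
  - 4 * a * (1 + a) * (pi ^+ 2 / (4 * n%:R)) - e / n%:R <= y - x /\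
  y - x <= pi ^+ 2 / (4 * n%:R) + e / n%:R.
Proof.
move=> a1 a0 e0; have p0 := pi_gt0 R.
have p4 : pi <= 4 :> R by have := pihalf_lt2 R; lra.
have e20 : 0 < e / 2 by rewrite divr_gt0.
near=> n; move=> x y xyc ax ya.
have n0 : 0 < n%:R :> R by rewrite ltr0n; near: n; exact: nbhs_infty_gt.
have big : 4 < n.+1%:R * (e / 2) by near: n; exact: near_infty_mulr_gt.
have [lo up] : pi * (- a * (1 + a)) * (pi - e / 2) / n.+1%:R <= y - x /\
    y - x <= pi / 4 * (pi + e / 2) / n.+1%:R.
  have ax' := ltW ax; have ya' := ltW ya; clear ax ya.
  by move: x y xyc ax' ya'; near: n; exact: consecutive_dist.
have N0 : 0 < n.+1%:R :> R by rewrite ltr0n.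
have nN : n.+1%:R = n%:R + 1 :> R by rewrite natr1.
have NV : n.+1%:R^-1 <= n%:R^-1 :> R by rewrite lef_pV2 ?posrE // ler_nat.
have m0 : 0 < - a * (1 + a) by apply: mulr_gt0; lra.
have m1 : - a * (1 + a) <= 4^-1 by have := sqr_ge0 (a + 2^-1); lra.
split.
  apply: le_trans lo.
  set m := - a * (1 + a) in m0 m1 *.
  rewrite ler_pdivlMr //.
  have -> : (- 4 * a * (1 + a) * (pi ^+ 2 / (4 * n%:R)) - e / n%:R) * n.+1%:R =
     (m * pi ^+ 2 - e) + (m * pi ^+ 2 - e) / n%:R.
    by rewrite nN /m; field; rewrite gt_eqF.
  have h1 : m * pi ^+ 2 <= 4 by nra.
  have h2 : (m * pi ^+ 2 - e) / n%:R <= e / 2.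
    rewrite ler_pdivrMr //; move: big; rewrite nN; lra.
  have h3 : pi * m <= 1 by nra.
  nra.
apply: le_trans up _.
have -> : pi ^+ 2 / (4 * n%:R) + e / n%:R = (pi ^+ 2 / 4 + e) / n%:R.
  by field; rewrite gt_eqF.
apply: ler_pM => //; rewrite ?invr_ge0 ?(ltW N0) //.
  by apply: mulr_ge0; lra.
nra.
Unshelve. all: by end_near. Qed.

End ZeroAsymptotics.
Unset Implicit Arguments.

Theorem theorem2 (R : realType) (P : nat -> {poly R})
    (P_geom : geometric_polys P) :
  [/\ forall j : nat,
        (fun n => zero_idx (P (2 * n)%N) j%:Z) =
        (fun n => - 2^-1 + pi ^+ 2 / 4 * (j%:R / (2 * n + 1)%:R))
          +o_\oo (fun n => n%:R^-1 : R),
      forall j : nat, (0 < j)%N ->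
        (fun n => zero_idx (P (2 * n + 1)%N) j%:Z) =
        (fun n => - 2^-1 + pi ^+ 2 / 8 * ((2 * j%:R - 1) / (2 * n + 2)%:R))
          +o_\oo (fun n => n%:R^-1 : R),
      forall (n : nat) (j : int),
        zero_idx (P n) (- j) + zero_idx (P n) j = -1,
      forall a : R, - 2^-1 < a -> a < 0 ->
        exists2 c : R, 0 < c & forall eps : R, 0 < eps ->
          \forall n \near \oo, forall x y : R,
            consecutive_zeros (P n) x y -> -1 - a < x -> y < a ->
            c * (pi ^+ 2 / (4 * n%:R)) <= y - x
              <= pi ^+ 2 / (4 * n%:R) + eps / n%:R
    & forall eps : R, 0 < eps ->
        exists2 a : R, - 2^-1 < a < 0 &
          \forall n \near \oo, forall x y : R,
            consecutive_zeros (P n) x y -> -1 - a < x -> y < a ->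
            `|y - x - pi ^+ 2 / (4 * n%:R)| <= eps / n%:R].
Proof.
have p0 := pi_gt0 R; have p2 := pi_ge2 R.
have p4 : pi <= 4 :> R by have := pihalf_lt2 R; lra.
split.
- case=> [|j].
    apply/eqaddoP => e e0; apply: nearW => n.
    by rewrite !fctE /= mulr0n mul0r mulr0 addr0 subrr normr0 mulr_ge0 // ltW.
  apply/eqaddoP => e e0.
  have [N _ hN] := right_zero_asymp P_geom j e0.
  (* Starting after N keeps n > 0, where the comparison function 1 / n is positive. *)
  exists N.+1 => // n /= Nn.
  have n0 : (0 < n)%N by apply: leq_trans Nn.
  have N2 : (N <= 2 * n)%N by lia.
  have := hN _ N2; rewrite oddM /= mul0r subr0 => h.
  rewrite !fctE /= addn1.
  apply: le_trans h _; rewrite ler_wpM2l ?(ltW e0) //.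
  rewrite ger0_norm ?invr_ge0 // lef_pV2 ?posrE ?ltr0n // ler_nat; lia.
- case=> // j _; apply/eqaddoP => e e0.
  have [N _ hN] := right_zero_asymp P_geom j e0.
  exists N.+1 => // n /= Nn.
  have n0 : (0 < n)%N by apply: leq_trans Nn.
  have N2 : (N <= 2 * n + 1)%N by lia.
  have := hN _ N2; rewrite oddD oddM /= => h.
  rewrite !fctE /=.
  have E (u D : R) : D != 0 ->
      pi ^+ 2 / 8 * ((2 * u - 1) / D) = pi ^+ 2 / 4 * ((u - 1 / 2) / D).
    by move=> D0; field.
  rewrite E; last by rewrite pnatr_eq0 addn2.
  rewrite (_ : (2 * n + 2)%N = (2 * n + 1).+1); last by lia.
  apply: le_trans h _; rewrite ler_wpM2l ?(ltW e0) //.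
  rewrite ger0_norm ?invr_ge0 // lef_pV2 ?posrE ?ltr0n // ler_nat; lia.
- exact: zero_idx_symm.
- move=> a a1 a0; pose m : R := - a * (1 + a).
  have m0 : 0 < m by apply: mulr_gt0; lra.
  (* Half of the constant 4 m from [consecutive_bulk]. The other half absorbs the error [d], so that
     the constant does not depend on eps. *)
  exists (2 * m); first by rewrite mulr_gt0.
  move=> e e0; pose d := Num.min e (m / 2).
  have d0 : 0 < d by rewrite lt_min e0 divr_gt0.
  have de : d <= e by rewrite ge_min lexx.
  have dm : d <= m / 2 by rewrite ge_min lexx orbT.
  near=> n; move=> x y xyc ax ya.
  have n0 : 0 < n%:R :> R by rewrite ltr0n; near: n; exact: nbhs_infty_gt.
  have [lo up] : - 4 * a * (1 + a) * (pi ^+ 2 / (4 * n%:R)) - d / n%:R <= y - x /\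
    y - x <= pi ^+ 2 / (4 * n%:R) + d / n%:R.
    by move: x y xyc ax ya; near: n; exact: consecutive_bulk.
  apply/andP; split.
    apply: le_trans lo.
    have -> : - 4 * a * (1 + a) * (pi ^+ 2 / (4 * n%:R)) - d / n%:R =
       (m * pi ^+ 2 - d) / n%:R by rewrite /m; field; rewrite gt_eqF.
    have -> : 2 * m * (pi ^+ 2 / (4 * n%:R)) = m * pi ^+ 2 / 2 / n%:R.
      by field; rewrite gt_eqF.
    have mp : m * 4 <= m * pi ^+ 2 by rewrite ler_pM2l //; nra.
    by rewrite ler_wpM2r ?invr_ge0 ?(ltW n0) //; lra.
  by apply: le_trans up _; rewrite lerD2l ler_wpM2r // invr_ge0 ltW.
(* For a = -1/2 + w the factor - 4 a (1 + a) is 1 - 4 w^2. The loss w^2 pi^2 is at most 4 w, because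
   w <= 1/4 and pi^2 <= 16, and hence below e / 2. *)
- move=> e e0; pose w := Num.min (4^-1) (e / 32) : R.
  have w0 : 0 < w by rewrite lt_min; apply/andP; split; lra.
  have we : w <= e / 32 by rewrite ge_min lexx orbT.
  have w4 : w <= 4^-1 by rewrite ge_min lexx.
  have a1 : - 2^-1 < - 2^-1 + w by lra.
  have a0 : - 2^-1 + w < 0 by lra.
  set a := - 2^-1 + w in a1 a0; exists a; first by rewrite a1 a0.
  have e20 : 0 < e / 2 by rewrite divr_gt0.
  near=> n; move=> x y xyc ax ya.
  have n0 : 0 < n%:R :> R by rewrite ltr0n; near: n; exact: nbhs_infty_gt.
  have [lo up] : - 4 * a * (1 + a) * (pi ^+ 2 / (4 * n%:R)) - e / 2 / n%:R <= y - x /\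
    y - x <= pi ^+ 2 / (4 * n%:R) + e / 2 / n%:R.
    by move: x y xyc ax ya; near: n; exact: consecutive_bulk.
  have e2 : e / 2 / n%:R <= e / n%:R by rewrite ler_wpM2r ?invr_ge0 ?(ltW n0) //; lra.
  rewrite ler_norml; apply/andP; split; last by lra.
  rewrite lerBrDr; apply: le_trans lo.
  have -> : - 4 * a * (1 + a) * (pi ^+ 2 / (4 * n%:R)) - e / 2 / n%:R =
    (pi ^+ 2 / 4 - w ^+ 2 * pi ^+ 2 - e / 2) / n%:R by rewrite /a; field; rewrite gt_eqF.
  have -> : - (e / n%:R) + pi ^+ 2 / (4 * n%:R) = (pi ^+ 2 / 4 - e) / n%:R.
    by field; rewrite gt_eqF.
  rewrite ler_wpM2r ?invr_ge0 ?(ltW n0) //.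
  have : pi ^+ 2 <= 16 :> R by nra.
  have : w ^+ 2 <= w / 4 by nra.
  have := sqr_ge0 w; have := sqr_ge0 (pi : R).
  move: (w ^+ 2) (pi ^+ 2 : R) => A B; nra.
Unshelve. all: by end_near. Qed.
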